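(* Let $k\in\mathbb N$ and let $f=\lambda z+\mathrm{h.o.t.}\in\mathcal L_k$ with $0<\lambda<1$. Write $$f=\lambda z+\sum_{\mathbf 0_k<\boldsymbol m\le \mathbf 1_k} a_{\boldsymbol m}\, z\,\boldsymbol\ell_1^{m_1}\cdots\boldsymbol\ell_k^{m_k}+\mathrm{h.o.t.},\qquad \boldsymbol m=(m_1,\dots,m_k)\in\mathbb Z^k,$$ and set $$f_0:=\lambda z+\sum_{\mathbf 0_k<\boldsymbol m\le \mathbf 1_k} a_{\boldsymbol m}\, z\,\boldsymbol\ell_1^{m_1}\cdots\boldsymbol\ell_k^{m_k}$$ (the comparison $\mathbf 0_k<\boldsymbol m\le\mathbf 1_k$ is lexicographic in $\mathbb Z^k$; here $\mathbf 0_k=(0,\dots,0)$, $\mathbf 1_k=(1,\dots,1)$). Then there exists a unique parabolic logarithmic transseries $\varphi\in\mathfrak L^0$ such that $\varphi\circ f\circ\varphi^{-1}=f_0$. Moreover $\varphi\in\mathcal L_k^0$.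
   Context: $z$ is an infinitesimal variable; $\boldsymbol\ell_1:=-1/\ln z$ and $\boldsymbol\ell_{j+1}:=\boldsymbol\ell_j\circ\boldsymbol\ell_1$. For $k\in\mathbb N$, $\mathcal L_k$ is the set of formal sums $f=\sum a_{\alpha,n_1,\dots,n_k}z^\alpha\boldsymbol\ell_1^{n_1}\cdots\boldsymbol\ell_k^{n_k}$ with real coefficients whose support $\mathrm{Supp}(f)=\{(\alpha,n_1,\dots,n_k):a_{\alpha,n_1,\dots,n_k}\neq0\}$ is a well-ordered subset of $\mathbb R_{\ge0}\times\mathbb Z^k$ for the lexicographic order. (A monomial with lexicographically larger exponent tuple is smaller, e.g. $z\prec\boldsymbol\ell_1\prec\boldsymbol\ell_2$.) $\mathcal L_m\subseteq\mathcal L_k$ for $m\le k$ in the obvious way (exponent tuples padded with zeros), and $\mathfrak L:=\bigcup_k\mathcal L_k$. The order $\mathrm{ord}(f)$ is the minimum of $\mathrm{Supp}(f)$; the leading term is the term of that order. ''h.o.t.'' means terms of strictly higher order. $f$ is parabolic if its leading term is $z$; the parabolic elements of $\mathcal L_k$ form a group $\mathcal L_k^0$ under composition of transseries (standard composition of logarithmic(-exponential) transseries), and $\mathfrak L^0:=\bigcup_k\mathcal L_k^0$. $\varphi^{-1}$ denotes the compositional inverse. *)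

(* Defs.v *)
From HB Require Import structures.
From mathcomp Require Import all_boot all_order all_algebra.
From mathcomp Require Import all_classical all_reals all_analysis.
Set Implicit Arguments. Unset Strict Implicit. Unset Printing Implicit Defensive.
Import Order.TTheory GRing.Theory Num.Theory.
Local Open Scope classical_set_scope.
Local Open Scope ring_scope.

(* Logarithmic transseries, encoded uniformly for all k.
   An exponent (alpha, n) : R * (nat -> int) stands for the monomial
   z^alpha * l_1^(n 0) * l_2^(n 1) * ... ; the series of L_k are those
   whose support lies in R_{>=0} x (sequences vanishing from index k on). *)
Section Transseries.
Variable R : realType.

Definition expo := (R * (nat -> int))%type.
Definition ser := expo -> R.

Definition nz : nat -> int := fun _ => 0.
Definition e_z : expo := (1, nz).
Definition e_one : expo := (0, nz).
Definition eadd (x y : expo) : expo := (x.1 + y.1, fun j => x.2 j + y.2 j).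

Definition lexlt (n m : nat -> int) : Prop :=
  exists j, (forall i, (i < j)%N -> n i = m i) /\ n j < m j.
Definition lexle (n m : nat -> int) : Prop := n = m \/ lexlt n m.
Definition elt (x y : expo) : Prop := x.1 < y.1 \/ (x.1 = y.1 /\ lexlt x.2 y.2).

Definition supp (f : ser) : set expo := [set e | f e != 0].
Definition well_ordered (S : set expo) : Prop :=
  forall A, A `<=` S -> A !=set0 -> exists2 x, A x & forall y, A y -> ~ elt y x.

Definition inL (k : nat) (f : ser) : Prop :=
  well_ordered (supp f) /\
  supp f `<=` [set e | 0 <= e.1 /\ forall j, (k <= j)%N -> e.2 j = 0].
Definition inLfrak (f : ser) : Prop := exists k, inL k f.

Definition lead_is (lam : R) (f : ser) : Prop :=
  f e_z = lam /\ forall e, f e != 0 -> e = e_z \/ elt e_z e.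
Definition parabolic (f : ser) : Prop := lead_is 1 f.
Definition inLk0 (k : nat) (f : ser) : Prop := inL k f /\ parabolic f.
Definition inL0 (f : ser) : Prop := inLfrak f /\ parabolic f.

Definition mono (x : expo) : ser := fun e => if pselect (e = x) then 1 else 0.
Definition cst (c : R) : ser := fun e => if pselect (e = e_one) then c else 0.
Definition sadd (f g : ser) : ser := fun e => f e + g e.
Definition sscale (c : R) (f : ser) : ser := fun e => c * f e.
Definition smul (f g : ser) : ser := fun e =>
  \sum_(p \in [set p : expo * expo | eadd p.1 p.2 = e]) f p.1 * g p.2.
Definition spow (f : ser) (n : nat) : ser := iter n (smul f) (cst 1).
Definition tsum (I : choiceType) (D : set I) (F : I -> ser) : ser :=
  fun e => \sum_(i \in D) F i e.

Definition idz : ser := mono e_z.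
(* the monomial l_(t+1) *)
Definition ell (t : nat) : ser := mono (0, fun j => if j == t then 1 else 0).
Definition geom (h : ser) : ser := tsum setT (fun n : nat => spow h n).
Definition log1p (h : ser) : ser :=
  tsum setT (fun n : nat => sscale ((-1) ^+ n / n.+1%:R) (spow h n.+1)).

(* For g = lam z + h.o.t. (lam > 0):
     g            = lam z (1 + eps g 0),
     l_(t+1) o g  = l_(t+1) (1 + eps g (t+1)),  where
     1 + eps g 1     = 1 / (1 - l_1 (ln lam + log(1 + eps g 0)))
     1 + eps g (t+2) = 1 / (1 - l_(t+2) log(1 + eps g (t+1))). *)
Definition lead (g : ser) : R := g e_z.
Fixpoint eps (g : ser) (t : nat) : ser :=
  match t with
  | 0%N => sadd (sscale (lead g)^-1 (fun e => g (e.1 + 1, e.2))) (cst (-1))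
  | t'.+1 => sadd (geom (smul (ell t')
                 (sadd (cst (if t' == 0%N then ln (lead g) else 0)) (log1p (eps g t')))))
               (cst (-1))
  end.

Definition gbinom (a : R) (i : nat) : R := (\prod_(r < i) (a - r%:R)) / i`!%:R.

(* exponent of the t-th "variable": t = 0 is z, t = s+1 is l_(s+1) *)
Definition vexp (x : expo) (t : nat) : R :=
  if t is s.+1 then (x.2 s)%:~R else x.1.

(* term of f o g indexed by an exponent x of f and a finitely supported
   multi-index i (given as a sequence with nonzero last entry):
   f_x lam^alpha z^alpha l^n prod_t binom(vexp x t, i_t) (eps g t)^(i_t) *)
Definition cterm (f g : ser) (p : expo * seq nat) : ser :=
  sscale (f p.1 * (lead g) `^ p.1.1 *
          \prod_(t < size p.2) gbinom (vexp p.1 t) (nth 0%N p.2 t))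
    (smul (mono p.1) (\big[smul/cst 1]_(t < size p.2) spow (eps g t) (nth 0%N p.2 t))).

Definition compose (f g : ser) : ser :=
  tsum [set p : expo * seq nat | f p.1 != 0 /\ last 1%N p.2 != 0%N] (cterm f g).

Definition onek (k : nat) : nat -> int := fun j => if (j < k)%N then 1 else 0.
Definition lin_part (k : nat) (f : ser) : ser := fun e =>
  if pselect (e.1 = 1 /\ lexle nz e.2 /\ lexle e.2 (onek k)) then f e else 0.

End Transseries.

(* Main.v *)
Require Import Defs.
From HB Require Import structures.
From mathcomp Require Import all_boot all_order all_algebra.
From mathcomp Require Import all_classical all_reals all_analysis.
From mathcomp Require Import ring.
Set Implicit Arguments. Unset Strict Implicit. Unset Printing Implicit Defensive.
Import Order.TTheory GRing.Theory Num.Theory.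
Local Open Scope classical_set_scope.
Local Open Scope ring_scope.

(** Logarithmic transseries are Hahn series over the ordered group of exponents,
    and by Neumann's lemma they form a commutative ring [hahn].  Composition on
    the right with a fixed [g] is the strongly linear ring morphism sending each
    monomial [x] to [x o g]; since both are determined by their values on
    monomials, associativity reduces to identities between binomial series
    [(1 + u)^a] and their logarithms.  The coefficients of such series are
    polynomials in [a], so these identities follow from the case of natural [a].

    Put [E phi = phi o f - f0 o phi].  If [phi - phi'] has leading term [c x],
    with [x = z^alpha l^n], then [E phi - E phi'] has leading term
    [(lam^alpha - lam) c x] if [alpha > 1], and [lam ln(lam) n_j c x l_1 ... l_j]
    if [alpha = 1], where [n_j] is the first nonzero entry of [n].  On exponents
    this is an order isomorphism from those above [z] onto those above
    [z l_1 ... l_k], which is where [f - f0] lives; hence [E phi = 0] has exactly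
    one parabolic solution, obtained as a union of partial solutions.  The same
    principle gives compositional inverses. *)

(** * The ordered group of exponents *)

(** The equation is kept in the form [phi o f = f0 o phi], which needs no inverse and is strongly
    linear in [phi] on the left. The product [l_1 ... l_j] arises as follows: [ln (lam z)] differs
    from [ln z] by [ln lam], so [l_1 o f] is [l_1 (1 + ln(lam) l_1 + ...)], and each further
    logarithm multiplies the relative change by one more factor, whence [l_j o f = l_j (1 + ln(lam)
    l_1 ... l_j + ...)]. For [alpha = 1] the contributions [lam c x] of the two sides cancel and
    this change is what remains; a parabolic change of variable therefore cannot reach the terms
    that [f0] keeps.

    Two points about depth shape the proof. [compose] sums over multi-indices of any length, while
    supports are controlled for finitely many variables at a time; composition is therefore studied
    at a truncation level [K], which loses nothing on series of depth [K]. Moreover a competing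
    [phi'] may have any depth, so uniqueness is proved at a level above all the depths involved. *)

Lemma lexlt_trans n m p : lexlt n m -> lexlt m p -> lexlt n p.
Proof.
move=> [i [hi ni]] [j [hj mj]]; exists (minn i j); split=> [l|].
  by rewrite leq_min => /andP[li lj]; rewrite hi // hj.
case: (ltngtP i j) => ij.
- by rewrite -(hj _ ij).
- by rewrite (hi _ ij).
- by move: ij ni mj => -> nm mp; apply: lt_trans nm mp.
Qed.

Lemma lexltxx n : ~ lexlt n n.
Proof. by move=> [j [_]]; rewrite ltxx. Qed.

Lemma lexlt_total n m : n = m \/ lexlt n m \/ lexlt m n.
Proof.
have [nm|nm] := pselect (forall i, n i = m i); first by left; apply/funext.
right; have /existsNP[i0 /eqP ni0] := nm.
have ex : exists i, n i != m i by exists i0.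
have minP := ex_minnP ex; case: minP => j nj jmin.
have eqj i : (i < j)%N -> n i = m i.
  by move=> ij; apply/eqP; apply/negPn/negP => /jmin; rewrite leqNgt ij.
by case: (ltgtP (n j) (m j)) nj => // h _; [left|right]; exists j; split=> // i /eqj.
Qed.

Lemma lexlt_add p n m : lexlt n m -> lexlt (fun j => p j + n j) (fun j => p j + m j).
Proof.
move=> [j [h hj]]; exists j; split=> [i ij|]; first by rewrite h.
by rewrite ltrD2l.
Qed.

Section Expo.
Variable R : realType.
Implicit Types x y z : expo R.

Lemma eltxx x : ~ elt x x.
Proof. by case=> [|[_ /lexltxx]]; rewrite ?ltxx. Qed.

Lemma elt_trans x y z : elt x y -> elt y z -> elt x z.
Proof.
move=> [xy|[xy nm]] [yz|[yz mp]].
- by left; apply: lt_trans xy yz.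
- by left; rewrite -yz.
- by left; rewrite xy.
- by right; split; [rewrite xy | apply: lexlt_trans nm mp].
Qed.

Lemma elt_total x y : x = y \/ elt x y \/ elt y x.
Proof.
case: (ltgtP x.1 y.1) => xy; [by right; left; left|by right; right; left|].
case: (lexlt_total x.2 y.2) => [nm|[nm|nm]].
- by left; case: x y xy nm => ? ? [? ?] /= -> ->.
- by right; left; right.
- by right; right; right.
Qed.

(** The group structure of the product makes [+] convertible to [eadd]. *)
HB.instance Definition _ := GRing.Zmodule.copy (expo R) (R * (nat -> int))%type.

Definition eleb x y := `[< x = y \/ elt x y >].
Definition eltb x y := `[< elt x y >].

Let eltb_def x y : eltb x y = (y != x) && eleb x y.
Proof.
apply/asboolP/andP => [xy|[/eqP yx /asboolP[xy|//]]].
  split; last by apply/asboolP; right.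
  by apply/eqP => e; move: xy; rewrite e; exact: eltxx.
by case: yx.
Qed.

Let eleb_anti : antisymmetric eleb.
Proof.
move=> x y /andP[/asboolP[//|xy] /asboolP[//|yx]].
by case: (eltxx (elt_trans xy yx)).
Qed.

Let eleb_trans : transitive eleb.
Proof.
move=> y x z /asboolP[->//|xy] /asboolP[<-|yz]; apply/asboolP; right=> //.
exact: elt_trans xy yz.
Qed.

Let eleb_refl : reflexive eleb.
Proof. by move=> x; apply/asboolP; left. Qed.

Let eleb_total : total eleb.
Proof.
move=> x y; case: (elt_total x y) => [->|[xy|yx]]; apply/orP.
- by left; apply: eleb_refl.
- by left; apply/asboolP; right.
- by right; apply/asboolP; right.
Qed.

HB.instance Definition _ := Order.isPOrder.Build ring_display (expo R)
  eltb_def eleb_refl eleb_anti eleb_trans.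
HB.instance Definition _ := Order.POrder_isTotal.Build ring_display (expo R) eleb_total.

Lemma eltE x y : (x < y) <-> elt x y.
Proof. by split => [/asboolP|?] //; apply/asboolP. Qed.

Lemma expo_ltD2l x y z : (x + y < x + z) = (y < z).
Proof.
have h a b c : b < c -> a + b < a + c :> expo R.
  move=> /eltE[bc|[bc nm]]; apply/eltE; first by left; rewrite ltrD2l.
  by right; split; [rewrite /= bc | apply: lexlt_add nm].
apply/idP/idP => [|/h//]; move=> /(h (- x)).
by rewrite !addrA addNr !add0r.
Qed.

Lemma expo_leD2l x y z : (x + y <= x + z) = (y <= z).
Proof. by rewrite !leNgt expo_ltD2l. Qed.
Lemma expo_ltD2r x y z : (y + x < z + x) = (y < z).
Proof. by rewrite ![_ + x]addrC expo_ltD2l. Qed.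
Lemma expo_leD2r x y z : (y + x <= z + x) = (y <= z).
Proof. by rewrite ![_ + x]addrC expo_leD2l. Qed.

Lemma expo_leD (x y z t : expo R) : x <= y -> z <= t -> x + z <= y + t.
Proof. by move=> xy zt; apply: (@le_trans _ _ (y + z)); rewrite ?expo_leD2r ?expo_leD2l. Qed.
Lemma expo_ltD (x y z t : expo R) : x < y -> z <= t -> x + z < y + t.
Proof. by move=> xy zt; apply: (@lt_le_trans _ _ (y + z)); rewrite ?expo_ltD2r ?expo_leD2l. Qed.
Lemma expo_letD (x y z t : expo R) : x <= y -> z < t -> x + z < y + t.
Proof. by move=> xy zt; apply: (@le_lt_trans _ _ (y + z)); rewrite ?expo_leD2r ?expo_ltD2l. Qed.

Lemma expo_leDr x y : 0 <= y -> x <= x + y.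
Proof. by move=> y0; rewrite -[X in X <= _]addr0 expo_leD2l. Qed.

Lemma expo_leN2 x y : (- x <= - y) = (y <= x).
Proof. by rewrite -(expo_leD2r (x + y) (- x)) addrA addNr add0r addrC addrK. Qed.

End Expo.

(** * Well-ordered sets and Neumann's lemma *)

Lemma dependent_choice (X : Type) (S : X -> X -> Prop) (x0 : X) :
  (forall x, exists y, S x y) ->
  exists u : nat -> X, u 0%N = x0 /\ forall n, S (u n) (u n.+1).
Proof.
move=> /choice[h hS]; by exists (fun n => iter n h x0).
Qed.

Lemma infinite_sequence (T : Type) (A : set T) : ~ finite_set A ->
  exists u : nat -> T, injective u /\ forall n, A (u n).
Proof.
move=> /infiniteP /card_leP [u].
pose i n : [set: nat] := SigSub (mem_set (I : setT n)).
exists (fun n => val (u (i n))); split; last first.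
  by move=> n; have := valP (u (i n)); rewrite inE.
by move=> m n /val_inj uu; have /(congr1 val) := inj (mem_set I) (mem_set I) uu.
Qed.

(* Nash-Williams: choose the terms of a bad sequence one after the other, each
   of minimal weight among the bad sequences sharing the terms chosen so far. *)
Lemma minimal_bad_sequence (X : Type) (w : X -> nat) (bad : X -> X -> Prop) :
  (exists u : nat -> X, forall i j, (i < j)%N -> bad (u i) (u j)) ->
  exists u : nat -> X, (forall i j, (i < j)%N -> bad (u i) (u j)) /\
    forall (v : nat -> X) k, (forall i, (i < k)%N -> v i = u i) ->
      (w (v k) < w (u k))%N -> ~ forall i j, (i < j)%N -> bad (v i) (v j).
Proof.
pose Bad (u : nat -> X) := forall i j, (i < j)%N -> bad (u i) (u j).
move=> [u0 bu0].
(* A state [(k, u)] is a bad sequence whose terms below [k] are settled; a step settles the term [k]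
   with minimal weight. *)
have step (p : nat * {u | Bad u}) : exists q : nat * {u | Bad u},
  q.1 = p.1.+1 /\ (forall i, (i < p.1)%N -> sval q.2 i = sval p.2 i) /\
  forall v, Bad v -> (forall i, (i < p.1)%N -> v i = sval p.2 i) ->
    (w (sval q.2 p.1) <= w (v p.1))%N.
  case: p => k [u bu] /=.
  pose Q m := `[< exists v, Bad v /\ (forall i, (i < k)%N -> v i = u i) /\ w (v k) = m >].
  have exQ : exists m, Q m by exists (w (u k)); apply/asboolP; exists u.
  case: (ex_minnP exQ) => m /asboolP[v [bv [vu vm]]] mmin.
  exists (k.+1, exist _ v bv); split=> //; split=> //= v' bv' v'u.
  by rewrite vm; apply: mmin; apply/asboolP; exists v'.
have [s [s0 sS]] := dependent_choice (0%N, exist _ u0 bu0) step.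
have s1 n : (s n).1 = n by elim: n => [|n IH]; [rewrite s0|rewrite (sS n).1 IH].
have agree m n i : (i < m)%N -> (m <= n)%N -> sval (s n).2 i = sval (s m).2 i.
  move=> im; elim: n => [|n IH]; first by rewrite leqn0 => /eqP ->.
  rewrite leq_eqVlt => /orP[/eqP->//|]; rewrite ltnS => mn.
  by rewrite -IH // (sS n).2.1 // s1 (leq_trans im).
(* The term [k] is settled in state [k.+1] and never changes afterwards. *)
pose t k := sval (s k.+1).2 k.
have tE n k : (k < n)%N -> t k = sval (s n).2 k by move=> kn; rewrite /t -(agree k.+1 n).
exists t; split=> [i j ij|v k vt wv bv].
  rewrite (tE j.+1 i (ltnW ij)); exact: (svalP (s j.+1).2 _ _ ij).
have := (sS k).2.2 v bv; rewrite s1 leqNgt => /(_ _)/negP; apply=> // i ik.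
by rewrite vt // (tE k).
Qed.

Section WellOrder.
Variable R : realType.
Local Notation G := (expo R).
Implicit Types (S T A : set G) (x y z e : G).

Lemma well_orderedP S : well_ordered S <->
  forall A, A `<=` S -> A !=set0 -> exists2 x, A x & forall y, A y -> x <= y.
Proof.
split=> h A AS A0; have [x Ax xmin] := h A AS A0; exists x => // y Ay.
  by rewrite leNgt; apply/negP => /eltE; apply: xmin.
by move=> /eltE; rewrite ltNge xmin.
Qed.

Lemma well_ordered_sub S T : S `<=` T -> well_ordered T -> well_ordered S.
Proof. by move=> ST h A AS; apply: h; apply: subset_trans AS ST. Qed.

(** Choose an index where [u] is minimal on a tail, then repeat beyond that index: each chosen term
    is the minimum of a tail containing all later choices. *)
Lemma well_ordered_monotone_subseq S (u : nat -> G) :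
  well_ordered S -> (forall n, S (u n)) ->
  exists h : nat -> nat, (forall i j, (i < j)%N -> (h i < h j)%N) /\
    forall i j, (i <= j)%N -> u (h i) <= u (h j).
Proof.
move=> /well_orderedP wS uS.
have ex n : exists i, (n <= i)%N /\ forall j, (n <= j)%N -> u i <= u j.
  have [||_ [i ni <-] imin] := wS (u @` [set i | (n <= i)%N]).
  - by move=> _ [i _ <-].
  - by exists (u n), n => /=.
  - by exists i; split=> // j nj; apply: imin; exists j.
have [m hm] := choice ex.
pose h := fix h n := if n is n'.+1 then m (h n').+1 else m 0%N.
have hS n : (h n < h n.+1)%N by rewrite /= (hm _).1.
have hlt i j : (i < j)%N -> (h i < h j)%N.
  elim: j => // j IH; rewrite ltnS leq_eqVlt => /orP[/eqP->//|/IH/ltn_trans]; apply.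
  exact: hS.
exists h; split=> // i j; rewrite leq_eqVlt => /orP[/eqP->//|/hlt hij].
case: i hij => [|i] hij; apply: (hm _).2 => //.
exact: ltn_trans (hS i) hij.
Qed.

(** A nonempty subset without minimum yields a strictly decreasing sequence, which has no good
    pair. *)
Lemma well_ordered_good S :
  (forall u : nat -> G, (forall n, S (u n)) ->
     exists i j, (i < j)%N /\ u i <= u j) -> well_ordered S.
Proof.
move=> good; apply/well_orderedP => A AS [a0 Aa0]; apply: contrapT => nomin.
have step (x : {x | A x}) : exists y : {x | A x}, sval y < sval x.
  case: x => x Ax /=; apply: contrapT => noy; apply: nomin; exists x => // y Ay.
  by rewrite leNgt; apply/negP => yx; apply: noy; exists (exist _ y Ay).
have [u [_ uS]] := dependent_choice (exist _ a0 Aa0) step.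
have [i [j [ij]]] := good (fun n => sval (u n)) (fun n => AS _ (svalP (u n))).
rewrite leNgt => /negP; apply.
elim: j ij => // j IH; rewrite ltnS leq_eqVlt => /orP[/eqP->//|/IH].
exact/lt_trans/uS.
Qed.

Definition sumset S T : set G := [set e | exists x y, [/\ S x, T y & e = x + y]].

Lemma sumset_good_pair S T (u v : nat -> G) : well_ordered S -> well_ordered T ->
  (forall n, S (u n)) -> (forall n, T (v n)) ->
  exists i j, [/\ (i < j)%N, u i <= u j & v i <= v j].
Proof.
move=> wS wT uS vT.
have [h [hlt hle]] := well_ordered_monotone_subseq wS uS.
have [h' [hlt' hle']] := well_ordered_monotone_subseq wT (fun n => vT (h n)).
exists (h (h' 0%N)), (h (h' 1%N)); split; last exact: hle'.
  by apply/hlt/hlt'.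
by apply/hle/ltnW/hlt'.
Qed.

Lemma well_ordered_sumset S T :
  well_ordered S -> well_ordered T -> well_ordered (sumset S T).
Proof.
move=> wS wT; apply: well_ordered_good => u uST.
have [a /choice[b ab]] := choice uST.
have [||i [j [ij aij bij]]] := sumset_good_pair (u := a) (v := b) wS wT.
- by move=> n; case: (ab n).
- by move=> n; case: (ab n).
exists i, j; split=> //; have [_ _ ->] := ab i; have [_ _ ->] := ab j.
exact: expo_leD.
Qed.

(** Among infinitely many decompositions, two would satisfy [x <= x'] and [e - x <= e - x'], hence
    coincide. *)
Lemma finite_decomposition S T e : well_ordered S -> well_ordered T ->
  finite_set [set x | S x /\ T (e - x)].
Proof.
move=> wS wT; apply: contrapT => /infinite_sequence[u [uinj uST]].
have [||i [j [ij aij]]] := sumset_good_pair (u := u) (v := fun n => e - u n) wS wT.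
- by move=> n; case: (uST n).
- by move=> n; case: (uST n).
rewrite expo_leD2l => bij; suff /uinj ij' : u i = u j by move: ij; rewrite ij' ltnn.
by apply/eqP; rewrite eq_le aij /= -expo_leN2.
Qed.

Lemma well_orderedU S T : well_ordered S -> well_ordered T -> well_ordered (S `|` T).
Proof.
move=> /well_orderedP wS /well_orderedP wT; apply/well_orderedP => A AST A0.
have min U : (forall B, B `<=` U -> B !=set0 -> exists2 x, B x & forall y, B y -> x <= y) ->
    (A `&` U) !=set0 -> exists2 x, (A `&` U) x & forall y, (A `&` U) y -> x <= y.
  by move=> h; apply: h => x [].
have [AS0|AS0] := pselect ((A `&` S) !=set0); last first.
  have [|x [Ax _] xmin] := min T wT.
    by case: A0 => a Aa; exists a; case: (AST _ Aa) => // Sa; case: AS0; exists a.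
  exists x => // y Ay; apply: xmin; split=> //.
  by case: (AST _ Ay) => // Sy; case: AS0; exists y.
have [x [Ax Sx] xmin] := min S wS AS0.
have [AT0|AT0] := pselect ((A `&` T) !=set0); last first.
  exists x => // y Ay; apply: xmin; split=> //.
  by case: (AST _ Ay) => // Ty; case: AT0; exists y.
have [x' [Ax' Tx'] xmin'] := min T wT AT0.
exists (Order.min x x') => [|y Ay]; first by rewrite /Order.min; case: ifP.
rewrite ge_min; case: (AST _ Ay) => ?; first by rewrite xmin.
by rewrite xmin' ?orbT.
Qed.

Fixpoint nsum A n : set G := if n is n'.+1 then sumset A (nsum A n') else [set 0].

Definition monoid_gen A : set G := [set e | exists n, nsum A n e].

Lemma nsum_ge0 A n e : (forall x, A x -> 0 < x) -> nsum A n e -> 0 <= e.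
Proof.
move=> A0; elim: n e => [e ->//|n IH _ [x [y [/A0 x0 /IH y0 ->]]]].
by rewrite -(addr0 0); apply: expo_leD => //; apply: ltW.
Qed.

Lemma nsum_gt0 A n e : (forall x, A x -> 0 < x) -> nsum A n.+1 e -> 0 < e.
Proof.
move=> A0 [x [y [/A0 x0 /(nsum_ge0 A0) y0 ->]]].
by rewrite -(addr0 0); apply: expo_ltD.
Qed.

(* Neumann's lemma.  The weight [n] of a decomposition takes the place of the
   length of a word in Higman's theorem. *)
Lemma nsum_good A (u : nat -> nat * G) : well_ordered A -> (forall x, A x -> 0 < x) ->
  (forall i, nsum A (u i).1 (u i).2) ->
  exists i j, (i < j)%N /\ ((u i).2 < (u j).2 \/ u i = u j).
Proof.
move=> wA A0 uA; apply: contrapT => nogood.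
pose X := {p : nat * G | nsum A p.1 p.2}.
pose bad (p q : X) := ~ ((sval p).2 < (sval q).2 \/ sval p = sval q).
have [|v [vbad vmin]] := @minimal_bad_sequence X (fun p => (sval p).1) bad.
  exists (fun i => exist _ (u i) (uA i)) => i j ij; rewrite /bad /= => uij.
  by apply: nogood; exists i, j.
(* A term of weight 0 is the exponent [0]: it is below every sum of positive weight and equal to any
   other term of weight 0, so it is in a good pair with its successor. *)
have vpos i : (0 < (sval (v i)).1)%N.
  rewrite lt0n; apply/eqP => vi0; have := vbad i i.+1 (ltnSn i); apply.
  have := svalP (v i); have := svalP (v i.+1).
  rewrite vi0 /=; case e: (sval (v i.+1)) => [[|n] y] /= hy hx.
    by right; case: (sval (v i)) vi0 hx => ? ? /= -> ->; rewrite hy.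
  by left; rewrite hx; apply: nsum_gt0 hy.
have dec i : exists ab : G * X, A ab.1 /\ (sval (v i)).2 = ab.1 + (sval ab.2).2 /\
    (sval (v i)).1 = (sval ab.2).1.+1.
  have := svalP (v i); case: (sval (v i)) (vpos i) => [[|n] e] //= _ [x [y [Ax yn ->]]].
  by exists (x, exist _ (n, y) yn).
have [ab abP] := choice dec.
have [h [hlt hle]] := well_ordered_monotone_subseq (u := fun n => (ab n).1) wA (fun n => (abP n).1).
(* From position [h 0] on, the terms are replaced along the subsequence by what remains after
   removing one summand. The weight at [h 0] drops, so by minimality [v'] is not bad; its good pair
   lifts to [v]. *)
pose v' n := if (n < h 0%N)%N then v n else (ab (h (n - h 0%N)%N)).2.
have ltv i : (sval (ab i).2).2 < (sval (v i)).2.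
  by have [/A0 a0 [-> _]] := abP i; rewrite -[X in X < _]add0r expo_ltD2r.
have := vmin v' (h 0%N); apply.
- by move=> i ih; rewrite /v' ih.
- by rewrite /v' ltnn subnn (abP _).2.2.
move=> i j ij; rewrite /v'; case: ifPn => ih; case: ifPn => jh.
- exact: vbad.
- move=> [l|l]; apply: (vbad i (h (j - h 0%N)%N)).
  + apply: leq_trans ih _; case: (posnP (j - h 0%N)%N) => [->//|/hlt/ltnW//].
  + by left; apply: lt_trans l _.
  + apply: leq_trans ih _; case: (posnP (j - h 0%N)%N) => [->//|/hlt/ltnW//].
  + by left; rewrite l.
- by move: (ltn_trans ij jh); rewrite (negbTE ih).
rewrite -!leqNgt in ih jh.
set i' := (i - h 0%N)%N; set j' := (j - h 0%N)%N.
have ij' : (i' < j')%N by rewrite ltn_sub2r // (leq_ltn_trans ih).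
have aij := hle _ _ (ltnW ij').
move=> l; apply: (vbad _ _ (hlt _ _ ij')).
have [_ [ei ni]] := abP (h i'); have [_ [ej nj]] := abP (h j').
case: l => l; first by left; rewrite ei ej; apply: expo_letD.
move: aij; rewrite le_eqVlt => /orP[/eqP aij|aij].
  by right; rewrite [LHS]surjective_pairing [RHS]surjective_pairing ei ej ni nj l aij.
by left; rewrite ei ej l expo_ltD2r.
Qed.

Lemma well_ordered_monoid_gen A :
  well_ordered A -> (forall x, A x -> 0 < x) -> well_ordered (monoid_gen A).
Proof.
move=> wA A0; apply: well_ordered_good => u /choice[n un].
have [i [j [ij l]]] := @nsum_good A (fun i => (n i, u i)) wA A0 un.
by exists i, j; split=> //; case: l => [/ltW//|[_ ->]].
Qed.

(** Apply [nsum_good] to the constant exponent [e] with distinct weights. This is why its good pairs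
    are either strict or equal together with their weights. *)
Lemma finite_nsum A e : well_ordered A -> (forall x, A x -> 0 < x) ->
  finite_set [set n | nsum A n e].
Proof.
move=> wA A0; apply: contrapT => /infinite_sequence[u [uinj un]].
have [i [j [ij []]]] := @nsum_good A (fun i => (u i, e)) wA A0 un.
  by rewrite /= ltxx.
by move=> [/uinj ij']; rewrite ij' ltnn in ij.
Qed.

Lemma nsum_add A m n x y : nsum A m x -> nsum A n y -> nsum A (m + n) (x + y).
Proof.
elim: m x => [x -> ny|m IH _ [a [b [Aa /IH mb ->]]] /mb mby]; first by rewrite add0r.
by exists a, (b + y); rewrite addrA.
Qed.

End WellOrder.

(** * Strong sums and strongly linear maps *)

Section FiniteSums.
Variable V : nmodType.

Lemma fsum_support (I : choiceType) (a : I -> V) (A : set I) :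
  (forall i, a i != 0 -> A i) -> \sum_(i \in [set: I]) a i = \sum_(i \in A) a i.
Proof.
move=> aA; apply/esym/fsbig_widen => // i [_ nAi] /=.
by apply/eqP; apply/negPn/negP => /aA.
Qed.

(** The finite box is essential: a sum over [\in] takes the value 0 as soon as infinitely many terms
    are nonzero. *)
Lemma fsum_exchange (I J : choiceType) (a : I -> J -> V) (A : set I) (B : set J) :
  finite_set A -> finite_set B -> (forall i j, a i j != 0 -> A i /\ B j) ->
  \sum_(i \in [set: I]) \sum_(j \in [set: J]) a i j =
  \sum_(j \in [set: J]) \sum_(i \in [set: I]) a i j.
Proof.
move=> fA fB aAB.
have z (K : choiceType) (b : K -> V) : \sum_(k \in [set: K]) b k != 0 -> exists k, b k != 0.
  move=> n0; apply: contrapT => nb; move: n0; rewrite fsbig1 ?eqxx// => k _.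
  by apply/eqP; apply/negPn/negP => bk; apply: nb; exists k.
rewrite (@fsum_support _ _ A); last by move=> i /z[j /aAB[]].
rewrite [RHS](@fsum_support _ _ B); last by move=> j /z[i /aAB[]].
rewrite (eq_fsbigr (fun i => \sum_(j \in B) a i j)); last first.
  by move=> i _; apply: fsum_support => j /aAB[].
rewrite exchange_fsbig //; apply: eq_fsbigr => j _.
by apply/esym/fsum_support => i /aAB[].
Qed.

Lemma fsum_pair (I J : choiceType) (a : I -> J -> V) (A : set I) (B : set J) :
  finite_set A -> finite_set B -> (forall i j, a i j != 0 -> A i /\ B j) ->
  \sum_(p \in [set: I * J]) a p.1 p.2 = \sum_(i \in [set: I]) \sum_(j \in [set: J]) a i j.
Proof.
move=> fA fB aAB.
rewrite (@fsum_support _ _ (A `*` B)); last by move=> [i j] /aAB.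
rewrite -pair_fsbig //; rewrite [RHS](@fsum_support _ _ A); last first.
  move=> i; apply: contra_neqP => nAi; rewrite fsbig1 // => j _.
  by apply/eqP; apply/negPn/negP => /aAB[].
apply: eq_fsbigr => i _; apply/esym/fsum_support => j /aAB[//].
Qed.

Lemma fsum_neq0 (I : choiceType) (D : set I) (a : I -> V) :
  \sum_(i \in D) a i != 0 -> exists2 i, D i & a i != 0.
Proof.
move=> n0; apply: contrapT => nb; move: n0; rewrite fsbig1 ?eqxx// => i Di.
by apply/eqP; apply/negPn/negP => bi; apply: nb; exists i.
Qed.

Lemma fsumD (I : choiceType) (a b : I -> V) :
  finite_set [set i | a i != 0] -> finite_set [set i | b i != 0] ->
  \sum_(i \in [set: I]) (a i + b i) = \sum_(i \in [set: I]) a i + \sum_(i \in [set: I]) b i.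
Proof.
move=> fa fb; pose A := [set i | a i != 0] `|` [set i | b i != 0].
have fA : finite_set A by rewrite finite_setU.
rewrite !(@fsum_support _ _ A); first by rewrite -fsbig_split.
- by right.
- by left.
move=> i; have [->|ai _] := eqVneq (a i) 0; last by left.
by rewrite add0r; right.
Qed.

Lemma fsum1 (I : choiceType) (a : I -> V) i0 :
  (forall i, i != i0 -> a i = 0) -> \sum_(i \in [set: I]) a i = a i0.
Proof.
move=> a0; rewrite (@fsum_support _ _ [set i0]) ?fsbig_set1// => i ai /=.
by apply: contra_neqP ai => /eqP /a0.
Qed.

End FiniteSums.

Lemma fsumB (V : idomainType) (I : choiceType) (a b : I -> V) :
  finite_set [set i | a i != 0] -> finite_set [set i | b i != 0] ->
  \sum_(i \in [set: I]) (a i - b i) = \sum_(i \in [set: I]) a i - \sum_(i \in [set: I]) b i.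
Proof.
move=> fa fb; rewrite fsumD //; last by apply: sub_finite_set fb => i /=; rewrite oppr_eq0.
rewrite -[in RHS]mulN1r mulr_fsumr; congr (_ + _).
by apply: eq_fsbigr => i _; rewrite mulN1r.
Qed.

Section StrongLinear.
Variable R : realType.
Local Notation G := (expo R).
Local Notation ser := (ser R).
Implicit Types (S T : set G) (x y z e : G) (f g h : ser).

Definition strongly_summable (I : choiceType) (F : I -> ser) :=
  (forall e, finite_set [set i | F i e != 0]) /\
  well_ordered [set e | exists i, F i e != 0].

Lemma well_ordered_tsum (I : choiceType) (D : set I) (F : I -> ser) :
  strongly_summable F -> well_ordered (supp (tsum D F)).
Proof.
by move=> [_]; apply: well_ordered_sub => e /fsum_neq0[i _ ?]; exists i.
Qed.

(* The strongly linear map sending the monomial [x] to [M x]; it is well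
   defined as soon as [M x] is supported in [x + T] for a fixed well-ordered
   [T]. *)
Definition slin (M : G -> ser) (f : ser) : ser :=
  fun e => \sum_(x \in [set: G]) f x * M x e.

Definition shifted (M : G -> ser) T := forall x e, M x e != 0 -> T (e - x).

Lemma slin_finite M T f e : well_ordered (supp f) -> well_ordered T -> shifted M T ->
  finite_set [set x | f x * M x e != 0].
Proof.
move=> wf wT MT; apply: sub_finite_set (finite_decomposition e wf wT) => x /=.
by rewrite mulf_eq0 negb_or => /andP[fx /MT].
Qed.

Lemma slin_support M T f : shifted M T -> supp (slin M f) `<=` sumset (supp f) T.
Proof.
move=> MT e /fsum_neq0[x _]; rewrite mulf_eq0 negb_or => /andP[fx /MT Tx].
by exists x, (e - x); split=> //; rewrite addrC subrK.
Qed.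

Lemma slin_well_ordered M T f : well_ordered (supp f) -> well_ordered T ->
  shifted M T -> well_ordered (supp (slin M f)).
Proof.
move=> wf wT /(@slin_support _ _ f) /well_ordered_sub; apply.
exact: well_ordered_sumset.
Qed.

(** At a fixed [e] only the finitely many [x] in [X e] contribute, and each lies in finitely many
    supports, so the double sum lives in a finite box. *)
Lemma slin_tsum (I : choiceType) M T (F : I -> ser) : well_ordered T ->
  shifted M T -> strongly_summable F ->
  strongly_summable (fun i => slin M (F i)) /\
  slin M (tsum setT F) = tsum setT (fun i => slin M (F i)).
Proof.
move=> wT MT [Ffin wF]; set S := [set e | _] in wF.
pose X e := [set x | S x /\ T (e - x)].
pose J e := \bigcup_(x in X e) [set i | F i x != 0].
have fX e : finite_set (X e) by apply: finite_decomposition.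
have fJ e : finite_set (J e) by apply: bigcup_finite.
have XJ e x i : F i x * M x e != 0 -> X e x /\ J e i.
  rewrite mulf_eq0 negb_or => /andP[Fx /MT Tx].
  have Xx : X e x by split=> //; exists i.
  by split=> //; exists x.
split.
  split=> [e|].
    by apply: sub_finite_set (fJ e) => i /fsum_neq0[x _ /XJ[]].
  apply: well_ordered_sub (well_ordered_sumset wF wT) => e [i /(slin_support MT)].
  by move=> [x [y [Fx Ty ->]]]; exists x, y; split=> //; exists i.
apply/funext => e; rewrite /slin /tsum -(fsum_exchange (fX e) (fJ e) (XJ e)).
by apply: eq_fsbigr => x _; rewrite mulr_fsuml.
Qed.

Lemma summable_slin M T f : well_ordered (supp f) -> well_ordered T -> shifted M T ->
  strongly_summable (fun x e => f x * M x e).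
Proof.
move=> wf wT MT; split=> [e|]; first exact: slin_finite MT.
apply: well_ordered_sub (well_ordered_sumset wf wT) => e [x].
rewrite mulf_eq0 negb_or => /andP[fx /MT Tx].
by exists x, (e - x); split=> //; rewrite addrC subrK.
Qed.

Lemma slin_comp M N T T' f : well_ordered (supp f) -> well_ordered T ->
  well_ordered T' -> shifted M T -> shifted N T' ->
  slin N (slin M f) = slin (fun x => slin N (M x)) f.
Proof.
move=> wf wT wT' MT NT'; have sM := summable_slin wf wT MT.
have [_] := slin_tsum wT' NT' sM; rewrite /tsum -/(slin M f) => ->.
apply/funext => e; apply: eq_fsbigr => x _; rewrite /slin mulr_fsumr.
by apply: eq_fsbigr => y _; rewrite mulrA.
Qed.

Definition translate g : G -> ser := fun x e => g (e - x).

Lemma shifted_translate g : shifted (translate g) (supp g).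
Proof. by []. Qed.

(** Multiplication by [g] is the strongly linear map sending [x] to [x g]; associativity of the
    product then comes from [slin_comp]. *)
Lemma smulE f g : smul f g = slin (translate g) f.
Proof.
apply/funext => e; rewrite /smul /slin.
rewrite (reindex_fsbig (fun x : G => (x, e - x)) setT).
  by apply: eq_fsbigr.
split.
- by move=> x _ /=; rewrite -[eadd _ _]/(x + (e - x)) addrC subrK.
- by move=> x y _ _ [].
move=> [x y] /= xy; exists x => //; congr pair.
by rewrite -xy -[eadd _ _]/(x + y) addrC addKr.
Qed.

Lemma smulC f g : smul f g = smul g f.
Proof.
rewrite !smulE; apply/funext => e; rewrite /slin /translate.
have bij : bijective (fun x : G => e - x).
  by exists (fun x => e - x) => x; rewrite opprB addrC subrK.
rewrite (reindex_fsbigT _ _ bij); apply: eq_fsbigr => x _.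
by rewrite mulrC opprB [e + _]addrC subrK.
Qed.

Lemma smul_well_ordered f g : well_ordered (supp f) -> well_ordered (supp g) ->
  well_ordered (supp (smul f g)).
Proof. by move=> wf wg; rewrite smulE; apply: slin_well_ordered wg _. Qed.

Lemma slin_translate M f x e :
  slin M (translate f x) e = \sum_(y \in [set: G]) f y * M (x + y) e.
Proof.
have bij : bijective (fun y : G => x + y).
  by exists (fun y => y - x) => y; [rewrite addrC addKr | rewrite addrC subrK].
rewrite /slin (reindex_fsbigT _ _ bij); apply: eq_fsbigr => y _.
by rewrite /translate [x + y]addrC addrK.
Qed.

Lemma smulA f g h : well_ordered (supp f) -> well_ordered (supp g) ->
  well_ordered (supp h) -> smul f (smul g h) = smul (smul f g) h.
Proof.
move=> wf wg wh; rewrite !smulE (@slin_comp _ _ (supp g) (supp h)) //.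
congr slin; apply/funext => x; apply/funext => e.
rewrite slin_translate /translate /slin; apply: eq_fsbigr => y _.
by rewrite opprD addrA.
Qed.

End StrongLinear.

(** * The ring of Hahn series *)

Identity Coercion fun_of_ser : ser >-> Funclass.

Section HahnRing.
Variable R : realType.
Local Notation G := (expo R).
Local Notation ser := (ser R).

Record hahn := Hahn { hval :> ser; hahn_wo : well_ordered (supp hval) }.
Arguments hahn_wo : clear implicits.

Lemma hahn_ext (f g : hahn) : (forall e, f e = g e) -> f = g.
Proof.
case: f g => [f wf] [g wg] /= /funext fg; move: wf wg; rewrite fg => wf wg.
by congr Hahn; apply: Prop_irrelevance.
Qed.

HB.instance Definition _ := gen_eqMixin hahn.
HB.instance Definition _ := gen_choiceMixin hahn.

Lemma well_ordered_set0 : well_ordered (set0 : set G).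
Proof. by move=> A A0 [a /A0]. Qed.

Lemma well_ordered_set1 (x : G) : well_ordered [set x].
Proof. by move=> A A1 [a Aa]; exists a => // y /A1 ->; rewrite (A1 _ Aa); apply: eltxx. Qed.

Lemma hzero_wo : well_ordered (supp (fun _ : G => 0 : R)).
Proof. by apply: well_ordered_sub well_ordered_set0 => e /=; rewrite /supp /= eqxx. Qed.
Definition hzero := Hahn hzero_wo.

Lemma hopp_wo (f : hahn) : well_ordered (supp (fun e => - f e)).
Proof.
have h : supp (fun e => - f e) `<=` supp f by move=> e; rewrite /supp /= oppr_eq0.
exact: well_ordered_sub h (hahn_wo f).
Qed.
Arguments hopp_wo : clear implicits.
Definition hopp f := Hahn (hopp_wo f).

Lemma hadd_wo (f g : hahn) : well_ordered (supp (sadd f g)).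
Proof.
apply: well_ordered_sub (well_orderedU (hahn_wo f) (hahn_wo g)) => e.
rewrite /supp /sadd /=; have [->|fe _] := eqVneq (f e) 0; last by left.
by rewrite add0r; right.
Qed.
Arguments hadd_wo : clear implicits.
Definition hadd f g := Hahn (hadd_wo f g).

Lemma hmul_wo (f g : hahn) : well_ordered (supp (smul f g)).
Proof. exact: smul_well_ordered (hahn_wo f) (hahn_wo g). Qed.
Arguments hmul_wo : clear implicits.
Definition hmul f g := Hahn (hmul_wo f g).

Lemma mono_wo (x : G) : well_ordered (supp (mono x)).
Proof.
apply: well_ordered_sub (@well_ordered_set1 x) => e.
by rewrite /supp /mono /=; case: (pselect (e = x)) => // _ /eqP.
Qed.
Arguments mono_wo : clear implicits.
Definition hmono x := Hahn (mono_wo x).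

Lemma cst_wo (c : R) : well_ordered (supp (Defs.cst c)).
Proof.
apply: well_ordered_sub (@well_ordered_set1 (e_one R)) => e.
by rewrite /supp /Defs.cst /=; case: (pselect (e = e_one R)) => // _ /eqP.
Qed.
Arguments cst_wo : clear implicits.
Definition hcst c := Hahn (cst_wo c).

Let haddA : associative hadd.
Proof. by move=> f g h; apply: hahn_ext => e; rewrite /= /sadd addrA. Qed.
Let haddC : commutative hadd.
Proof. by move=> f g; apply: hahn_ext => e; rewrite /= /sadd addrC. Qed.
Let hadd0 : left_id hzero hadd.
Proof. by move=> f; apply: hahn_ext => e; rewrite /= /sadd add0r. Qed.
Let haddN : left_inverse hzero hopp hadd.
Proof. by move=> f; apply: hahn_ext => e; rewrite /= /sadd addNr. Qed.

HB.instance Definition _ := GRing.isZmodule.Build hahn haddA haddC hadd0 haddN.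

Lemma hmulE (f g : hahn) e : hmul f g e = \sum_(x \in [set: G]) f x * g (e - x).
Proof. by rewrite /= smulE. Qed.

Lemma hmul_finite (f g : hahn) e : finite_set [set x | f x * g (e - x) != 0].
Proof. exact: slin_finite (hahn_wo f) (hahn_wo g) (@shifted_translate _ g). Qed.

Let hmulA : associative hmul.
Proof.
by move=> f g h; apply: hahn_ext => e /=; rewrite smulA //; apply: hahn_wo.
Qed.
Let hmulC : commutative hmul.
Proof. by move=> f g; apply: hahn_ext => e /=; rewrite smulC. Qed.

Lemma hcst_mul c (f : hahn) e : hmul (hcst c) f e = c * f e.
Proof.
rewrite hmulE (@fsum1 _ _ _ (0 : G)).
  by rewrite subr0 /= /Defs.cst; case: pselect.
by move=> x /eqP x0; rewrite /= /Defs.cst; case: pselect => [xE|?]; [case: (x0 xE)|rewrite mul0r].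
Qed.

Let hmul1 : left_id (hcst 1) hmul.
Proof. by move=> f; apply: hahn_ext => e; rewrite hcst_mul mul1r. Qed.
Let hmulDl : left_distributive hmul hadd.
Proof.
move=> f g h; apply: hahn_ext => e.
rewrite hmulE [RHS]/(sadd _ _ e) /sadd !hmulE -fsumD; try exact: hmul_finite.
by apply: eq_fsbigr => x _; rewrite /= /sadd mulrDl.
Qed.
Let h1n0 : hcst 1 != hzero.
Proof.
apply/eqP => /(congr1 (fun f : hahn => f 0)) /=; rewrite /Defs.cst; case: pselect => //.
by move=> _ /eqP; rewrite oner_eq0.
Qed.

HB.instance Definition _ := GRing.Zmodule_isComNzRing.Build hahn
  hmulA hmulC hmul1 hmulDl h1n0.

Implicit Types (f g h : hahn) (e x y : G).

Lemma hvalD f g e : (f + g) e = f e + g e. Proof. by []. Qed.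
Lemma hvalN f e : (- f) e = - f e. Proof. by []. Qed.
Lemma hvalB f g e : (f - g) e = f e - g e. Proof. by []. Qed.
Lemma hval0 e : (0 : hahn) e = 0. Proof. by []. Qed.
Lemma hvalM f g e : (f * g) e = \sum_(x \in [set: G]) f x * g (e - x).
Proof. exact: hmulE. Qed.
Lemma hvalZ c f e : (hcst c * f) e = c * f e.
Proof. exact: hcst_mul. Qed.

Lemma hval_sum (I : Type) (r : seq I) (P : pred I) (F : I -> hahn) e :
  (\sum_(i <- r | P i) F i) e = \sum_(i <- r | P i) F i e.
Proof. by apply: (big_morph (fun f : hahn => f e)). Qed.

Lemma hmonoE x e : hmono x e = (e == x)%:R.
Proof. by rewrite /= /mono; case: pselect => /= h; case: eqP. Qed.

Lemma hcstE c e : hcst c e = if e == 0 then c else 0.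
Proof. by rewrite /= /Defs.cst; case: pselect => /= h; case: eqP. Qed.

Lemma hcst1 : hcst 1 = 1. Proof. by []. Qed.
Lemma hcst0 : hcst 0 = 0.
Proof. by apply: hahn_ext => e; rewrite hcstE if_same. Qed.
Lemma hcstM a b : hcst (a * b) = hcst a * hcst b.
Proof.
by apply: hahn_ext => e; rewrite hvalZ !hcstE; case: ifP; rewrite ?mulr0.
Qed.
Lemma hcstD a b : hcst (a + b) = hcst a + hcst b.
Proof.
by apply: hahn_ext => e; rewrite hvalD !hcstE; case: ifP; rewrite ?addr0.
Qed.
Lemma hcstN a : hcst (- a) = - hcst a.
Proof.
by apply: hahn_ext => e; rewrite hvalN !hcstE; case: ifP; rewrite ?oppr0.
Qed.

Lemma hmonoM x f e : (hmono x * f) e = f (e - x).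
Proof.
rewrite hvalM (@fsum1 _ _ _ x) ?hmonoE ?eqxx ?mul1r// => y yx.
by rewrite hmonoE (negbTE yx) mul0r.
Qed.

Lemma hmonoD x y : hmono (x + y) = hmono x * hmono y.
Proof. by apply: hahn_ext => e; rewrite hmonoM !hmonoE subr_eq [y + x]addrC. Qed.

Lemma hmono0 : hmono 0 = 1.
Proof. by rewrite -hcst1; apply: hahn_ext => e; rewrite hmonoE hcstE; case: eqP. Qed.

Lemma spowE f n : spow f n = hval (f ^+ n).
Proof. by elim: n => [//|n IH]; rewrite /spow iterS -/(spow f n) IH exprS. Qed.

Lemma well_ordered_supp_family (E : nat -> hahn) N :
  well_ordered [set e | exists2 t, (t < N)%N & E t e != 0].
Proof.
elim: N => [|N IH].
  by apply: well_ordered_sub well_ordered_set0 => x [t].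
apply: well_ordered_sub (well_orderedU IH (hahn_wo (E N))) => x [t].
by rewrite ltnS leq_eqVlt => /orP[/eqP-> ?|tN ?]; [right|left; exists t].
Qed.

End HahnRing.
Arguments hval0 {R}.
Arguments hahn_wo {R}.

(** * Leading terms and power series *)

Section Leading.
Variable R : realType.
Local Notation G := (expo R).
Local Notation hahn := (hahn R).
Implicit Types (f g h u v : hahn) (e x y : G) (a b : R).

(* [f = a * e + h.o.t.], where [a = 0] is allowed and then means that every
   term of [f] has order strictly greater than [e]. *)
Definition ldt e a f := (forall x, x < e -> f x = 0) /\ f e = a.

Lemma ldt_eq e e' a a' f : ldt e a f -> e = e' -> a = a' -> ldt e' a' f.
Proof. by move=> ? <- <-. Qed.

Lemma ldt00 e : ldt e 0 0. Proof. by []. Qed.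

Lemma ldtD e a b f g : ldt e a f -> ldt e b g -> ldt e (a + b) (f + g).
Proof.
move=> [f0 fe] [g0 ge]; split=> [x xe|]; rewrite hvalD ?fe ?ge//.
by rewrite f0 // g0 // addr0.
Qed.

Lemma ldtN e a f : ldt e a f -> ldt e (- a) (- f).
Proof.
by move=> [f0 fe]; split=> [x xe|]; rewrite hvalN ?fe// f0 // oppr0.
Qed.

Lemma ldtB e a b f g : ldt e a f -> ldt e b g -> ldt e (a - b) (f - g).
Proof. by move=> fe /ldtN; apply: ldtD. Qed.

Lemma ldt_lt e e' a f : e < e' -> ldt e' a f -> ldt e 0 f.
Proof.
by move=> ee [f0 _]; split=> [x xe|]; apply: f0 => //; apply: lt_trans xe ee.
Qed.

Lemma ldt_le e e' f : e <= e' -> ldt e' 0 f -> ldt e 0 f.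
Proof. by rewrite le_eqVlt => /orP[/eqP->//|/ldt_lt]; apply. Qed.

Lemma ldt_supp_gt e f : ldt e 0 f <-> forall x, f x != 0 -> e < x.
Proof.
split=> [[f0 fe] x|fe].
  by apply: contra_neqT; rewrite -leNgt le_eqVlt => /orP[/eqP->|/f0].
split=> [x xe|]; apply/eqP; apply/negPn/negP => /fe; last by rewrite ltxx.
by rewrite ltNge (ltW xe).
Qed.

Lemma ldt_supp_ge e a f : ldt e a f -> forall x, f x != 0 -> e <= x.
Proof. by move=> [f0 _] x; apply: contra_neqT; rewrite -ltNge => /f0. Qed.

Lemma ldtM e e' a b f g : ldt e a f -> ldt e' b g -> ldt (e + e') (a * b) (f * g).
Proof.
move=> [f0 fe] [g0 ge]; split=> [y yee|]; rewrite hvalM.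
  rewrite fsbig1 // => x _; case: (ltP x e) => xe; first by rewrite f0 ?mul0r.
  rewrite g0 ?mulr0// -(expo_ltD2r x) subrK; apply: lt_le_trans yee _.
  by rewrite addrC expo_leD2l.
rewrite (@fsum1 _ _ _ e) => [|x].
  by rewrite fe [e + e']addrC addrK ge.
rewrite neq_lt => /orP[/f0->|ex]; first by rewrite mul0r.
by rewrite g0 ?mulr0// -(expo_ltD2r x) subrK [e + _]addrC expo_ltD2l.
Qed.

Lemma ldt_hmono x : ldt x 1 (hmono x).
Proof.
by split=> [y yx|]; rewrite hmonoE ?eqxx// lt_eqF.
Qed.

Lemma ldt_hcst a : ldt 0 a (hcst a).
Proof. by split=> [y y0|]; rewrite hcstE ?eqxx// lt_eqF. Qed.

Lemma ldtZ e a b f : ldt e a f -> ldt e (b * a) (hcst b * f).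
Proof. by move=> /(ldtM (ldt_hcst b)); rewrite add0r. Qed.

Lemma ldt_shift x e a f : ldt e a f -> ldt (x + e) a (hmono x * f).
Proof. by move=> /(ldtM (ldt_hmono x)); rewrite mul1r. Qed.

Lemma ldt_exists f : f != 0 -> exists e, f e != 0 /\ ldt e (f e) f.
Proof.
move=> f0; have /well_orderedP/(_ (supp f))[] // := hahn_wo f.
  apply: contrapT => s0; move/eqP: f0; apply; apply: hahn_ext => e.
  by apply/eqP; apply/negPn/negP => fe; apply: s0; exists e.
move=> e fe emin; exists e; split=> //; split=> // x xe.
by apply/eqP; apply/negPn/negP => /emin; rewrite leNgt xe.
Qed.

Lemma ldt_fsum (I : choiceType) (F : I -> hahn) (b : I -> R) e f :
  (forall x, f x = \sum_(i \in [set: I]) F i x) -> (forall i, ldt e (b i) (F i)) ->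
  ldt e (\sum_(i \in [set: I]) b i) f.
Proof.
move=> fE Fb; split=> [x xe|]; rewrite fE.
  by rewrite fsbig1 // => i _; apply: (Fb i).1.
by apply: eq_fsbigr => i _; rewrite (Fb i).2.
Qed.

Lemma mul_supp f g : supp (f * g) `<=` sumset (supp f) (supp g).
Proof.
by move=> e; rewrite /supp /= smulE; apply: slin_support; apply: shifted_translate.
Qed.

Lemma exprn_supp A h n : supp h `<=` A -> supp (h ^+ n) `<=` nsum A n.
Proof.
move=> hA; elim: n => [|n IH] e.
  rewrite /supp [X in X -> _]/= -[Defs.cst 1]/(hval (hcst 1)) hcstE.
  by case: (e =P 0) => [->//|_]; rewrite eqxx.
rewrite exprS => /mul_supp[x [y [/hA Ax /IH ny ->]]].
by exists x, y.
Qed.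

Definition hsum (I : choiceType) (F : I -> hahn) : hahn :=
  match pselect (well_ordered (supp (tsum setT (fun i => F i : ser R)))) with
  | left w => Hahn w
  | right _ => 0
  end.

Lemma hsum_val (I : choiceType) (F : I -> hahn) : strongly_summable (fun i => F i : ser R) ->
  hsum F = tsum setT (fun i => F i : ser R) :> ser R.
Proof. by move=> /(@well_ordered_tsum _ _ setT) w; rewrite /hsum; case: pselect. Qed.

Lemma hsumE (I : choiceType) (F : I -> hahn) e : strongly_summable (fun i => F i : ser R) ->
  hsum F e = \sum_(i \in [set: I]) F i e.
Proof. by move=> /hsum_val ->. Qed.

(** The infinitesimals, at which every power series can be evaluated. *)
Definition pos f := ldt 0 0 f.

Lemma posP f : pos f <-> forall x, supp f x -> 0 < x.
Proof. exact: ldt_supp_gt. Qed.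

Lemma posD f g : pos f -> pos g -> pos (f + g).
Proof. by move=> pf pg; have := ldtD pf pg; rewrite addr0. Qed.

Lemma posN f : pos f -> pos (- f).
Proof. by move=> /ldtN; rewrite oppr0. Qed.

Lemma posM f g a : pos f -> ldt 0 a g -> pos (f * g).
Proof. by move=> pf pg; have := ldtM pf pg; rewrite addr0 mul0r. Qed.

Definition pw (c : nat -> R) h : hahn := hsum (fun n => hcst (c n) * h ^+ n).

Lemma exprn_finite h e : pos h -> finite_set [set n | (h ^+ n) e != 0].
Proof.
move=> /posP h0; apply: sub_finite_set (finite_nsum e (hahn_wo h) h0) => n.
exact: exprn_supp.
Qed.

Lemma scaled_finite (I : choiceType) (c a : I -> R) :
  finite_set [set i | a i != 0] -> finite_set [set i | c i * a i != 0].
Proof.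
by apply: sub_finite_set => i /=; rewrite mulf_eq0 negb_or => /andP[].
Qed.

Lemma summable_pw c h : pos h -> strongly_summable (fun n => hcst (c n) * h ^+ n : ser R).
Proof.
move=> ph; split=> [e|].
  apply: sub_finite_set (scaled_finite c (exprn_finite e ph)) => n.
  by rewrite /mkset hvalZ.
apply: well_ordered_sub (well_ordered_monoid_gen (hahn_wo h) ((posP h).1 ph)) => e [n].
rewrite hvalZ mulf_eq0 negb_or => /andP[_ hn]; exists n.
exact: exprn_supp hn.
Qed.

Lemma pwE c h e : pos h -> pw c h e = \sum_(n \in [set: nat]) c n * (h ^+ n) e.
Proof.
move=> /(summable_pw c) s; rewrite /pw hsumE //.
by apply: eq_fsbigr => n _; rewrite hvalZ.
Qed.

Lemma pw_supp c A h : pos h -> supp h `<=` A -> supp (pw c h) `<=` monoid_gen A.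
Proof.
move=> ph hA e; rewrite /supp /= pwE // => /fsum_neq0[n _].
rewrite mulf_eq0 negb_or => /andP[_ hn]; exists n.
exact: exprn_supp hn.
Qed.

Lemma pw0 c : pw c 0 = hcst (c 0%N).
Proof.
apply: hahn_ext => e; rewrite pwE; last exact: ldt00.
rewrite (@fsum1 _ _ _ 0%N) => [|n n0]; last by rewrite expr0n (negbTE n0) mulr0.
by rewrite expr0 -hvalZ mulr1.
Qed.

(** For [n >= 2] the difference is [u - v] times an infinitesimal, so only [n = 1] is visible at
    [e]. For a power series this leaves the linear coefficient. *)
Lemma ldt_exprnB e a u v n : pos u -> pos v -> ldt e a (u - v) ->
  ldt e (if n is 1%N then a else 0) (u ^+ n - v ^+ n).
Proof.
move=> pu pv uv; case: n => [|n]; first by rewrite subrr; apply: ldt00.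
elim: n => [|n IH]; first by rewrite !expr1.
rewrite (_ : _ - _ = u * (u ^+ n.+1 - v ^+ n.+1) + v ^+ n.+1 * (u - v)); last first.
  by rewrite !exprS; ring.
rewrite -[X in ldt _ X]addr0; apply: ldtD.
  by have := ldtM pu IH; rewrite add0r mul0r.
have pvn : pos (v ^+ n.+1).
  elim: n {IH} => [|n IH]; first by rewrite expr1.
  by rewrite exprS; apply: posM IH.
by have := ldtM pvn uv; rewrite add0r mul0r.
Qed.

Lemma ldt_pwB c e a u v : pos u -> pos v -> ldt e a (u - v) ->
  ldt e (c 1%N * a) (pw c u - pw c v).
Proof.
move=> pu pv uv.
have -> : c 1%N * a = \sum_(n \in [set: nat]) c n * (if n is 1%N then a else 0).
  by rewrite (@fsum1 _ _ _ 1%N) // => -[|[|n]] // _; rewrite mulr0.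
apply: (@ldt_fsum _ (fun n => hcst (c n) * (u ^+ n - v ^+ n))).
  move=> x; rewrite hvalB !pwE // -fsumB; try exact/scaled_finite/exprn_finite.
  by apply: eq_fsbigr => n _; rewrite hvalZ hvalB mulrBr.
by move=> n; apply: ldtZ; apply: ldt_exprnB.
Qed.

Lemma ldt_pw c u : pos u -> ldt 0 (c 0%N) (pw c u).
Proof.
move=> pu; have p0 : pos (0 : hahn) by apply: ldt00.
have := @ldt_pwB c 0 0 u 0 pu p0; rewrite subr0 pw0 mulr0 => /(_ pu).
by move=> /(ldtD (ldt_hcst (c 0%N))); rewrite addr0 addrC subrK.
Qed.

Definition geom_coef (n : nat) : R := 1.
Definition log_coef (n : nat) : R := if n is m.+1 then (-1) ^+ m / m.+1%:R else 0.

Lemma geomE h : pos h -> geom h = pw geom_coef h :> ser R.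
Proof.
move=> ph; apply/funext => e; rewrite pwE // /geom /tsum.
by apply: eq_fsbigr => n _; rewrite mul1r spowE.
Qed.

Lemma log1pE h : pos h -> log1p h = pw log_coef h :> ser R.
Proof.
move=> ph; apply/funext => e; rewrite pwE // /log1p /tsum.
(* [log1p] starts at the first power, so its index is shifted by one against [log_coef], which
   vanishes at 0. *)
rewrite [RHS](@fsum_support _ _ _ (range succn)); last first.
  by case=> [|n]; [rewrite /= mul0r eqxx | exists n].
rewrite fsbig_image; last by move=> m n _ _ [].
by apply: eq_fsbigr => n _; rewrite /sscale spowE.
Qed.

End Leading.

(** * Binomial powers and logarithms *)

Section BinomialPowers.
Variable R : realType.
Local Notation G := (expo R).
Local Notation hahn := (hahn R).
Implicit Types (f g h u v w : hahn) (e x y : G) (a b : R).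

(** In characteristic zero the naturals below [size (p - q)] are too many distinct roots for a
    nonzero [p - q]. *)
Lemma poly_nat_ext (p q : {poly R}) : (forall m : nat, p.[m%:R] = q.[m%:R]) -> p = q.
Proof.
move=> pq; apply/eqP; rewrite -subr_eq0; apply/negPn/negP => d0.
pose s := [seq (i%:R : R) | i <- iota 0 (size (p - q))].
have := @max_poly_roots _ (p - q) s d0; rewrite size_map size_iota ltnn.
have su : uniq s by rewrite map_inj_uniq ?iota_uniq// => i j /eqP; rewrite eqr_nat => /eqP.
rewrite su => H; suff /H/(_ isT) : all (root (p - q)) s by [].
by apply/allP => _ /mapP[i _ ->]; rewrite /root hornerD hornerN pq subrr.
Qed.

Lemma gbinom_nat m n : gbinom (m%:R : R) n = 'C(m, n)%:R.
Proof.
rewrite /gbinom; apply: (@mulIf _ n`!%:R); first by rewrite pnatr_eq0 -lt0n fact_gt0.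
rewrite divfK; last by rewrite pnatr_eq0 -lt0n fact_gt0.
rewrite -natrM bin_ffact; have [nm|mn] := leqP n m.
  rewrite ffact_prod natr_prod; apply: eq_bigr => i _.
  by rewrite natrB // ltnW // (leq_trans _ nm).
by rewrite ffact_small // (bigD1 (Ordinal mn)) //= subrr mul0r.
Qed.

Definition binom_poly n : {poly R} := n`!%:R^-1 *: \prod_(r < n) ('X - r%:R%:P).

Lemma horner_binom_poly n a : (binom_poly n).[a] = gbinom a n.
Proof.
rewrite hornerZ horner_prod /gbinom mulrC; congr (_ * _).
by apply: eq_bigr => r _; rewrite !hornerE.
Qed.

(** Expresses that [log (1 + u)] is the derivative of [(1 + u)^a] at [a = 0]; logarithms are thereby
    read off from polynomials in [a]. *)
Lemma coef1_binom_poly n : (binom_poly n)`_1 = log_coef R n.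
Proof.
rewrite /binom_poly coefZ; case: n => [|n].
  by rewrite big_ord0 coef1 mulr0.
rewrite big_ord_recl /= subr0 coefXM /= -horner_coef0 horner_prod.
rewrite (eq_bigr (fun r : 'I_n => (-1) * r.+1%:R)); last first.
  by move=> r _; rewrite !hornerE mulN1r.
rewrite big_split /= prodr_const card_ord -natr_prod.
rewrite -(big_mkord xpredT succn) -(big_add1 _ _ 0 n.+1 xpredT id) -fact_prod factS natrM.
have : (n`!%:R : R) != 0 by rewrite pnatr_eq0 -lt0n fact_gt0.
have : (n.+1%:R : R) != 0 by rewrite pnatr_eq0.
by move: (n.+1%:R : R) (n`!%:R : R) => b c b0 c0; field; rewrite b0.
Qed.

Definition hpow u a := pw (gbinom a) u.
Definition hlog u := pw (@log_coef R) u.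

(** The coefficient of [e] in [(1 + u)^a] as a function of [a]: a polynomial, because only finitely
    many powers of an infinitesimal [u] reach [e]. *)
Definition coef_poly u e : {poly R} := \sum_(n \in [set: nat]) (u ^+ n) e *: binom_poly n.

Lemma fsum_raddf (V W : zmodType) (phi : {additive V -> W}) (I : choiceType) (F : I -> V) :
  finite_set [set i | F i != 0] ->
  phi (\sum_(i \in [set: I]) F i) = \sum_(i \in [set: I]) phi (F i).
Proof.
move=> fF; set A := [set i | _] in fF.
rewrite !(@fsum_support _ _ _ A) //; first by rewrite !fsbig_finite // raddf_sum.
by move=> i; apply: contra_neqP => /negP/negPn/eqP ->; rewrite raddf0.
Qed.

Lemma coef_poly_finite u e : pos u ->
  finite_set [set n | (u ^+ n) e *: binom_poly n != 0].
Proof.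
move=> pu; apply: sub_finite_set (exprn_finite e pu) => n; rewrite /mkset.
by apply: contra_neq => ->; rewrite scale0r.
Qed.

Lemma horner_coef_poly u e a : pos u -> (coef_poly u e).[a] = hpow u a e.
Proof.
move=> pu; rewrite /hpow pwE // -[LHS]/(horner_eval a _) fsum_raddf; last exact: coef_poly_finite.
by apply: eq_fsbigr => n _; rewrite -[LHS]/(((u ^+ n) e *: binom_poly n).[a]) hornerZ horner_binom_poly mulrC.
Qed.

Lemma coef1_coef_poly u e : pos u -> (coef_poly u e)`_1 = hlog u e.
Proof.
move=> pu; rewrite /hlog pwE // -[LHS]/(coefp 1 _) fsum_raddf; last exact: coef_poly_finite.
by apply: eq_fsbigr => n _; rewrite -[LHS]/(((u ^+ n) e *: binom_poly n)`_1) coefZ coef1_binom_poly mulrC.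
Qed.

Lemma hvalMn f n e : (f *+ n) e = f e *+ n.
Proof. by elim: n => [//|n IH]; rewrite !mulrS hvalD IH. Qed.

Lemma hpow_nat u m : pos u -> hpow u m%:R = (1 + u) ^+ m.
Proof.
move=> pu; apply: hahn_ext => e; rewrite /hpow pwE // exprDn hval_sum.
rewrite (fsbig_ord (GRing.add : Monoid.com_law 0)
  m.+1 (fun i => (1 ^+ (m - i) * u ^+ i *+ 'C(m, i)) e)).
rewrite (@fsum_support _ _ _ `I_m.+1) => [|n].
  apply: eq_fsbigr => n _; rewrite hvalMn expr1n mul1r gbinom_nat.
  by rewrite mulr_natl.
by rewrite /= ltnS gbinom_nat leqNgt; apply: contra_neqN => mn; rewrite bin_small ?mul0r.
Qed.

Lemma hpow0 u : pos u -> hpow u 0 = 1.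
Proof. by move=> /(hpow_nat 0); rewrite expr0. Qed.

Lemma hpow1 u : pos u -> hpow u 1 = 1 + u.
Proof. by move=> /(hpow_nat 1); rewrite expr1. Qed.

(** The range must be the same for all exponents [a], so that a coefficient of a product of powers
    is one polynomial in [a]. *)
Lemma mul_coef_range u v e : pos u -> pos v -> exists X : seq G, forall f g,
  supp f `<=` monoid_gen (supp u) -> supp g `<=` monoid_gen (supp v) ->
  (f * g) e = \sum_(x <- X) f x * g (e - x).
Proof.
move=> /posP pu /posP pv.
pose X := [set x | monoid_gen (supp u) x /\ monoid_gen (supp v) (e - x)].
have fX : finite_set X.
  by apply: finite_decomposition; apply: well_ordered_monoid_gen => //; apply: hahn_wo.
exists (finmap.enum_fset (fset_set X)) => f g fu gv; rewrite hvalM (@fsum_support _ _ _ X).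
  by rewrite fsbig_finite.
by move=> x; rewrite mulf_eq0 negb_or => /andP[/fu ? /gv].
Qed.

Lemma hpow_supp u a : pos u -> supp (hpow u a) `<=` monoid_gen (supp u).
Proof. by move=> pu; apply: pw_supp. Qed.

Lemma pos_mul1D u v : pos u -> pos v -> pos (u + v + u * v).
Proof.
by move=> pu pv; apply: posD; [apply: posD|apply: posM pv].
Qed.

(* Each coefficient of both sides is a polynomial in the exponent, so that the
   identity only has to be checked for natural exponents. *)
Lemma coef_poly_mul1D u v e : pos u -> pos v -> exists X : seq G,
  (coef_poly (u + v + u * v) e = \sum_(x <- X) coef_poly u x * coef_poly v (e - x)) /\
  (forall f g, supp f `<=` monoid_gen (supp u) -> supp g `<=` monoid_gen (supp v) ->
    (f * g) e = \sum_(x <- X) f x * g (e - x)).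
Proof.
move=> pu pv; have [X XE] := mul_coef_range e pu pv; exists X; split=> //.
apply: poly_nat_ext => m; have pw := pos_mul1D pu pv.
rewrite horner_coef_poly // hpow_nat //.
rewrite (_ : 1 + (u + v + u * v) = (1 + u) * (1 + v)); last by ring.
rewrite exprMn -!hpow_nat // XE; try exact: hpow_supp.
by rewrite horner_sum; apply: eq_bigr => x _; rewrite hornerM !horner_coef_poly.
Qed.

Lemma hpowM u v a : pos u -> pos v -> hpow (u + v + u * v) a = hpow u a * hpow v a.
Proof.
move=> pu pv; apply: hahn_ext => e; have [X [pE XE]] := coef_poly_mul1D e pu pv.
rewrite -horner_coef_poly; last exact: pos_mul1D.
rewrite pE XE; try exact: hpow_supp.
by rewrite horner_sum; apply: eq_bigr => x _; rewrite hornerM !horner_coef_poly.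
Qed.

(* Compare the coefficients of [a] in [(1 + u)^a (1 + v)^a], a polynomial in [a]. *)
Lemma hlogM u v : pos u -> pos v -> hlog (u + v + u * v) = hlog u + hlog v.
Proof.
move=> pu pv; apply: hahn_ext => e; have [X [pE XE]] := coef_poly_mul1D e pu pv.
rewrite -coef1_coef_poly; last exact: pos_mul1D.
have c0 w x : pos w -> (coef_poly w x)`_0 = (1 : hahn) x.
  by move=> pw; rewrite -horner_coef0 horner_coef_poly // hpow0.
have s1 w : pos w -> supp (1 : hahn) `<=` monoid_gen (supp w).
  by move=> pw; rewrite -(hpow0 pw); apply: hpow_supp.
have sl w : pos w -> supp (hlog w) `<=` monoid_gen (supp w).
  by move=> pw; apply: pw_supp.
rewrite pE coef_sum (_ : hlog u + hlog v = 1 * hlog v + hlog u * 1); last by ring.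
rewrite hvalD !XE; try by [apply: s1|apply: sl].
rewrite -big_split; apply: eq_bigr => x _ /=.
by rewrite coefM !big_ord_recl big_ord0 /= addr0 !c0 // !coef1_coef_poly.
Qed.

(** Each coefficient is polynomial in either exponent separately: extend from naturals first in [a],
    for natural [b], and then in [b]. *)
Lemma hpowD u a b : pos u -> hpow u (a + b) = hpow u a * hpow u b.
Proof.
move=> pu; apply: hahn_ext => e; have [X XE] := mul_coef_range e pu pu.
rewrite XE; try exact: hpow_supp.
have cE c d : \sum_(x <- X) hpow u c x * hpow u d (e - x) =
    (\sum_(x <- X) coef_poly u x * (hpow u d (e - x))%:P).[c].
  rewrite horner_sum; apply: eq_bigr => x _.
  by rewrite hornerM hornerC horner_coef_poly.
have dE c d : \sum_(x <- X) hpow u c x * hpow u d (e - x) =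
    (\sum_(x <- X) (hpow u c x)%:P * coef_poly u (e - x)).[d].
  rewrite horner_sum; apply: eq_bigr => x _.
  by rewrite hornerM hornerC horner_coef_poly.
have sE c d : hpow u (c + d) e = (coef_poly u e \Po ('X + d%:P)).[c].
  by rewrite horner_comp !hornerE horner_coef_poly.
have nat_right c (m : nat) :
    hpow u (c + m%:R) e = \sum_(x <- X) hpow u c x * hpow u m%:R (e - x).
  rewrite cE sE; congr (_.[c]); apply: poly_nat_ext => k.
  rewrite -cE -sE -natrD !hpow_nat // exprD -!hpow_nat // XE //; exact: hpow_supp.
rewrite dE addrC sE; congr (_.[b]); apply: poly_nat_ext => k.
by rewrite -dE -sE addrC nat_right.
Qed.

Lemma gbinomN1 n : gbinom (-1 : R) n = (-1) ^+ n.
Proof.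
rewrite /gbinom (eq_bigr (fun r : 'I_n => -1 * r.+1%:R)); last first.
  by move=> r _; rewrite -natr1; ring.
rewrite big_split /= prodr_const card_ord -natr_prod.
rewrite -(big_mkord xpredT succn) -(big_add1 _ _ 0 n.+1 xpredT id) -fact_prod.
by rewrite mulfK // pnatr_eq0 -lt0n fact_gt0.
Qed.

Definition hgeom h := pw (@geom_coef R) h.

(** Makes [hgeomM] an instance of [hpowD] with exponents [1] and [-1]. *)
Lemma hgeom_hpow h : pos h -> hgeom h = hpow (- h) (-1).
Proof.
move=> ph; have pN := posN ph; apply: hahn_ext => e; rewrite /hgeom /hpow !pwE //.
apply: eq_fsbigr => n _; rewrite gbinomN1 /geom_coef mul1r.
rewrite -hvalZ (_ : hcst _ = (-1) ^+ n); last first.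
  by elim: n => [|n IH]; rewrite ?expr0// !exprS -IH hcstM hcstN.
by rewrite -exprMn mulrNN mul1r.
Qed.

Lemma hgeomM h : pos h -> (1 - h) * hgeom h = 1.
Proof.
move=> ph; have pN := posN ph; rewrite hgeom_hpow // -(hpow1 pN) -hpowD // addrN.
exact: hpow0.
Qed.

End BinomialPowers.

(** * Strongly linear endomorphisms *)

Section HahnLinear.
Variable R : realType.
Local Notation G := (expo R).
Local Notation hahn := (hahn R).
Variables (M : G -> hahn) (T : set G).
Hypotheses (wT : well_ordered T) (MT : shifted (fun x => M x : ser R) T).
Implicit Types (f g h u v w : hahn) (e x y : G) (a b : R).

Definition hlin f := hsum (fun x => hcst (f x) * M x).

Lemma hlin_val f : hlin f = slin (fun x => M x : ser R) f :> ser R.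
Proof.
have E : (fun x => hcst (f x) * M x : ser R) = (fun x e => f x * M x e).
  by apply/funext => x; apply/funext => e; rewrite -hvalZ.
rewrite /hlin hsum_val E //.
exact: summable_slin (hahn_wo f) wT MT.
Qed.

Lemma hlinE f e : hlin f e = \sum_(x \in [set: G]) f x * M x e.
Proof. by rewrite hlin_val. Qed.

Lemma hlin_finite f e : finite_set [set x | f x * M x e != 0].
Proof. exact: slin_finite (hahn_wo f) wT MT. Qed.

Lemma hlinD f g : hlin (f + g) = hlin f + hlin g.
Proof.
apply: hahn_ext => e; rewrite hvalD !hlinE -fsumD; try exact: hlin_finite.
by apply: eq_fsbigr => x _; rewrite hvalD mulrDl.
Qed.

Lemma hlinZ a f : hlin (hcst a * f) = hcst a * hlin f.
Proof.
apply: hahn_ext => e; rewrite hvalZ !hlinE mulr_fsumr.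
by apply: eq_fsbigr => x _; rewrite hvalZ mulrA.
Qed.

Lemma hlinN f : hlin (- f) = - hlin f.
Proof. by rewrite -mulN1r -[- 1]hcstN hlinZ hcstN hcst1 mulN1r. Qed.

Lemma hlinB f g : hlin (f - g) = hlin f - hlin g.
Proof. by rewrite hlinD hlinN. Qed.

Lemma hlin_hmono x : hlin (hmono x) = M x.
Proof.
apply: hahn_ext => e; rewrite hlinE (@fsum1 _ _ _ x) => [|y yx].
  by rewrite hmonoE eqxx mul1r.
by rewrite hmonoE (negbTE yx) mul0r.
Qed.

Lemma hlin_hsum (I : choiceType) (F : I -> hahn) :
  strongly_summable (fun i => F i : ser R) -> hlin (hsum F) = hsum (fun i => hlin (F i)).
Proof.
move=> sF; have [sS E] := slin_tsum wT MT sF.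
have E' : (fun i => hlin (F i) : ser R) = (fun i => slin (fun x => M x : ser R) (F i)).
  by apply/funext => i; rewrite hlin_val.
apply: hahn_ext => e; rewrite hsumE; last by rewrite E'.
rewrite hlin_val hsum_val // E /tsum.
by apply: eq_fsbigr => i _; rewrite hlin_val.
Qed.

Hypotheses (M0 : M 0 = 1) (MD : forall x y, M (x + y) = M x * M y).

Lemma hlin1 : hlin 1 = 1.
Proof. by rewrite -[X in hlin X]hmono0 hlin_hmono. Qed.

Lemma hlin_hcst a : hlin (hcst a) = hcst a.
Proof. by rewrite -[hcst a]mulr1 hlinZ hlin1. Qed.

(** Both sides are strongly linear in [f], and so is the product with a fixed series; it is enough
    to compare them when [f] is a monomial, where [MD] applies termwise to [g]. *)
Lemma hlinM f g : hlin (f * g) = hlin f * hlin g.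
Proof.
have mul_slin (p q : hahn) : p * q = slin (translate q) p :> ser R by rewrite /= smulE.
have right (x : G) : slin (fun y => M y : ser R) (translate g x) = hval (M x * hlin g).
  rewrite mulrC mul_slin hlin_val (slin_comp (hahn_wo g) wT (hahn_wo (M x)) MT) //.
  apply/funext => e; rewrite slin_translate; apply: eq_fsbigr => y _.
  by rewrite MD [M x * _]mulrC mul_slin.
apply: hahn_ext => e; rewrite hlin_val !mul_slin (hlin_val f).
rewrite (slin_comp (hahn_wo f) (hahn_wo g) wT (@shifted_translate _ g) MT).
rewrite (slin_comp (hahn_wo f) wT (hahn_wo (hlin g)) MT (@shifted_translate _ (hlin g))).
by apply: eq_fsbigr => x _; rewrite right mul_slin.
Qed.

Lemma hlinX f n : hlin (f ^+ n) = hlin f ^+ n.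
Proof. by elim: n => [|n IH]; rewrite ?expr0 ?hlin1 // !exprS hlinM IH. Qed.

Lemma hlin_pw c u : pos u -> pos (hlin u) -> hlin (pw c u) = pw c (hlin u).
Proof.
move=> pu plu; rewrite /pw hlin_hsum; last exact: summable_pw.
by congr hsum; apply/funext => n; rewrite hlinZ hlinX.
Qed.

Lemma hlin_prod (I : Type) (r : seq I) (F : I -> hahn) :
  hlin (\prod_(i <- r) F i) = \prod_(i <- r) hlin (F i).
Proof. exact: (big_morph _ hlinM hlin1). Qed.

End HahnLinear.

Lemma hlin_comp (R : realType) (M N : expo R -> hahn R) (S T : set (expo R)) f :
  well_ordered S -> well_ordered T -> shifted (fun x => M x : ser R) S ->
  shifted (fun x => N x : ser R) T -> hlin N (hlin M f) = hlin (fun x => hlin N (M x)) f.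
Proof.
move=> wS wT MS NT; pose NM x := hlin N (M x).
have E x : NM x = slin (fun y => N y : ser R) (M x) :> ser R by apply: hlin_val wT NT _.
have NMST : shifted (fun x => NM x : ser R) (sumset S T).
  move=> x y; rewrite E => /(slin_support NT)[z [w [/MS Sz Tw ->]]].
  by exists (z - x), w; split=> //; rewrite addrAC.
apply: hahn_ext => e; rewrite (hlin_val wT NT) (hlin_val wS MS).
rewrite (slin_comp (hahn_wo f) wS wT MS NT).
rewrite [RHS](hlinE (well_ordered_sumset wS wT) NMST).
by apply: eq_fsbigr => x _; rewrite -E.
Qed.

(** * Composition as a ring morphism *)

HB.lock Definition heps (R : realType) (g : hahn R) : nat -> hahn R :=
  fix heps t := match t with
  | 0%N => hcst (g (e_z R))^-1 * (hmono (- e_z R) * g) - 1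
  | s.+1 => hgeom (hmono (0, fun j => if j == s then 1 else 0) *
              (hcst (if s == 0%N then ln (g (e_z R)) else 0) + hlog (heps s))) - 1
  end.

(* [x o g], truncated to the variables [z, l_1, ..., l_K]. *)
HB.lock Definition Mg (R : realType) (K : nat) (g : hahn R) (x : expo R) : hahn R :=
  hmono x *
  (hcst (g (e_z R) `^ x.1) * \prod_(t < K.+1) hpow (heps g t) (vexp x t)).

(** This is [f o g]: the inner series comes first. *)
HB.lock Definition hcomp (R : realType) (K : nat) (g f : hahn R) : hahn R :=
  hlin (Mg K g) f.

Section Composition.
Variable R : realType.
Local Notation G := (expo R).
Local Notation hahn := (hahn R).
Local Notation ez := (e_z R).
Implicit Types (f g h u v w : hahn) (e x y : G) (a b : R) (t K : nat).

Definition ev t : G := (0, fun j => if j == t then 1 else 0).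

Lemma ev_gt0 t : 0 < ev t.
Proof.
apply/eltE; right; split=> //; exists t; split=> [i it|] /=; last by rewrite eqxx.
by rewrite ltn_eqF.
Qed.

(** Series [a z + h.o.t.] with [a > 0], the admissible inner series of a composition. *)
Definition adm g := (forall x, x < ez -> g x = 0) /\ 0 < g ez.

Lemma adm_ldt g : adm g -> ldt ez (g ez) g.
Proof. by move=> [g0 _]. Qed.

Lemma adm_of_ldt a g : 0 < a -> ldt ez a g -> adm g.
Proof. by move=> a0 [g0 ga]; split; rewrite ?ga. Qed.

Definition hell t := hmono (ev t).

(* The logarithm of [(v o g) / v], where [v] is [z] for [t = 0] and [l_t] otherwise. *)
Definition hL g t := hcst (if t == 0%N then ln (g ez) else 0) + hlog (heps g t).

Lemma hepsS g t : heps g t.+1 = hgeom (hell t * hL g t) - 1.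
Proof. by rewrite /hL !heps.unlock. Qed.

Lemma heps0 g : heps g 0 = hcst (g ez)^-1 * (hmono (- ez) * g) - 1.
Proof. by rewrite heps.unlock. Qed.

Lemma heps1 g t : 1 + heps g t.+1 = hgeom (hell t * hL g t).
Proof. by rewrite hepsS addrC subrK. Qed.

Lemma ldt_hL g t : pos (heps g t) ->
  ldt 0 (if t == 0%N then ln (g ez) else 0) (hL g t).
Proof.
move=> pe; apply: ldt_eq (ldtD (ldt_hcst _) (ldt_pw (@log_coef R) pe)) _ _ => //.
exact: addr0.
Qed.

Lemma pos_ellL g t : pos (heps g t) -> pos (hell t * hL g t).
Proof.
move=> /ldt_hL Lt; apply: posM Lt; apply: ldt_lt (ev_gt0 t) (ldt_hmono _).
Qed.

Lemma pos_heps g t : adm g -> pos (heps g t).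
Proof.
move=> ag; have d1 f : ldt 0 1 f -> pos (f - 1).
  by move=> f1; have := ldtB f1 (ldt_hcst 1); rewrite subrr.
elim: t => [|t IH].
  rewrite heps0; apply: d1; have := ldtZ (g ez)^-1 (ldt_shift (- ez) (adm_ldt ag)).
  by rewrite addNr mulVf // gt_eqF //; case: ag.
by rewrite hepsS; apply: d1; apply: (ldt_pw (@geom_coef R)); apply: pos_ellL.
Qed.

Lemma eps_val g t : adm g -> eps g t = heps g t :> ser R.
Proof.
move=> ag; elim: t => [|t IH].
  apply/funext => e.
  rewrite heps0 -hcst1 -hcstN.
  rewrite hvalD hvalZ hmonoM opprK -[eps g 0 e]/((g ez)^-1 * g (e.1 + 1, e.2) + hcst (-1) e).
  congr (_ * g _ + _); rewrite [RHS]surjective_pairing; congr pair.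
  by apply/funext => j; rewrite -[RHS]/(e.2 j + 0) addr0.
have -> : eps g t.+1 = sadd (geom (smul (@ell R t) (sadd
    (Defs.cst (if t == 0%N then ln (lead g) else 0)) (log1p (eps g t))))) (Defs.cst (-1)) by [].
rewrite IH log1pE; last exact: pos_heps.
rewrite hepsS -hcst1 -hcstN; apply: (congr1 (fun s => sadd s (Defs.cst (-1)))).
exact (@geomE _ (hell t * hL g t) (pos_ellL (pos_heps t ag))).
Qed.

Definition eps_supp K g : set G := [set e | exists2 t, (t <= K)%N & heps g t e != 0].

Lemma eps_supp_wo K g : well_ordered (eps_supp K g).
Proof. exact: (@well_ordered_supp_family _ (heps g) K.+1). Qed.
Arguments eps_supp_wo : clear implicits.

Lemma eps_supp_gt0 K g : adm g -> forall x, eps_supp K g x -> 0 < x.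
Proof. by move=> ag x [t _]; apply: (posP _).1; apply: pos_heps. Qed.

Lemma monoid_gen1 (A : set G) : supp (1 : hahn) `<=` monoid_gen A.
Proof.
by move=> e; rewrite -[1](@expr0 _ (0 : hahn)) => /(@exprn_supp _ A) h; exists 0%N;
  apply: h => x; rewrite /supp /= eqxx.
Qed.

Lemma monoid_genM (A : set G) f g : supp f `<=` monoid_gen A -> supp g `<=` monoid_gen A ->
  supp (f * g) `<=` monoid_gen A.
Proof.
move=> fA gA e /mul_supp[x [y [/fA[m mx] /gA[n ny] ->]]].
by exists (m + n)%N; apply: nsum_add.
Qed.

Lemma monoid_genZ (A : set G) a f : supp f `<=` monoid_gen A ->
  supp (hcst a * f) `<=` monoid_gen A.
Proof.
by move=> fA e; rewrite /supp /mkset hvalZ mulf_eq0 negb_or => /andP[_ /fA].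
Qed.

Lemma MgE K g x : Mg K g x =
  hmono x * (hcst (g ez `^ x.1) * \prod_(t < K.+1) hpow (heps g t) (vexp x t)).
Proof. by rewrite Mg.unlock. Qed.

Lemma hcomp_hlin K g f : hcomp K g f = hlin (Mg K g) f.
Proof. by rewrite hcomp.unlock. Qed.

(** The exponent [x] influences the coefficients of the binomial powers but not the monoid
    containing their supports. Since [K] bounds the number of variables, the generators form a
    finite union of well-ordered sets. *)
Lemma shifted_Mg K g : adm g ->
  shifted (fun x => Mg K g x : ser R) (monoid_gen (eps_supp K g)).
Proof.
move=> ag x e; rewrite MgE hmonoM; apply: monoid_genZ.
apply: (big_ind (fun f => supp f `<=` monoid_gen (eps_supp K g))).
- exact: monoid_gen1.
- exact: monoid_genM.
move=> t _; apply: pw_supp; first exact: pos_heps.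
by move=> y hy; exists t => //; rewrite -ltnS.
Qed.

Lemma monoid_gen_eps_wo K g : adm g -> well_ordered (monoid_gen (eps_supp K g)).
Proof.
move=> ag; apply: well_ordered_monoid_gen (eps_supp_wo K g) _.
exact: eps_supp_gt0.
Qed.
Arguments monoid_gen_eps_wo K [g].

Lemma vexp0 t : vexp (0 : G) t = 0. Proof. by case: t. Qed.

Lemma vexpD x y t : vexp (x + y) t = vexp x t + vexp y t.
Proof. by case: t => [//|t]; rewrite /vexp -intrD. Qed.

Lemma vexp_ez t : vexp ez t = if t == 0%N then 1 else 0.
Proof. by case: t. Qed.

Lemma vexp_ev s t : vexp (ev s) t = if t == s.+1 then 1 else 0.
Proof. by case: t => [//|t]; rewrite /= eqSS; case: ifP. Qed.

Lemma Mg0 K g : adm g -> Mg K g 0 = 1.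
Proof.
move=> ag; rewrite !MgE hmono0 mul1r powRr0 hcst1 mul1r big1 // => t _.
by rewrite vexp0 hpow0 //; apply: pos_heps.
Qed.

Lemma MgD K g x y : adm g -> Mg K g (x + y) = Mg K g x * Mg K g y.
Proof.
move=> ag; rewrite !MgE hmonoD powRD; last by case: ag => _ /gt_eqF ->; rewrite implybT.
rewrite hcstM (eq_bigr (fun t : 'I__ => hpow (heps g t) (vexp x t) * hpow (heps g t) (vexp y t))).
  by rewrite big_split /=; ring.
by move=> t _; rewrite vexpD hpowD //; apply: pos_heps.
Qed.

Lemma ldt_Mg K g x : adm g -> ldt x (g ez `^ x.1) (Mg K g x).
Proof.
move=> ag; have p1 : ldt 0 1 (\prod_(t < K.+1) hpow (heps g t) (vexp x t)).
  apply: (big_ind (ldt 0 1)); first exact: ldt_hcst.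
    by move=> f h f1 h1; have := ldtM f1 h1; rewrite addr0 mulr1.
  move=> t _; have := ldt_pw (gbinom (vexp x t)) (pos_heps t ag).
  by rewrite /gbinom big_ord0 divr1.
by rewrite MgE; have := ldt_shift x (ldtZ (g ez `^ x.1) p1); rewrite addr0 mulr1.
Qed.

Lemma Mg_hpow1 K g x (t0 : 'I_K.+1) : adm g ->
  (forall t, vexp x t = if t == t0 :> nat then 1 else 0) ->
  Mg K g x = hmono x * (hcst (g ez `^ x.1) * (1 + heps g t0)).
Proof.
move=> ag xt; rewrite !MgE (bigD1 t0) //= big1 => [|t tt0].
  by rewrite mulr1 xt eqxx hpow1 //; apply: pos_heps.
by rewrite xt ifN // hpow0 //; apply: pos_heps.
Qed.

Lemma adm_fact g : adm g -> g = hcst (g ez) * (hmono ez * (1 + heps g 0)).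
Proof.
move=> ag; rewrite heps0 [1 + _]addrC subrK.
have -> : hmono ez * (hcst (g ez)^-1 * (hmono (- ez) * g)) =
    hcst (g ez)^-1 * (hmono ez * hmono (- ez) * g) by ring.
by rewrite -hmonoD subrr hmono0 mul1r mulrA -hcstM divff ?hcst1 ?mul1r// gt_eqF //; case: ag.
Qed.

Lemma Mg_ez K g : adm g -> Mg K g ez = g.
Proof.
move=> ag; rewrite (@Mg_hpow1 _ _ _ ord0) //; last exact: vexp_ez.
by rewrite powRr1 ?ltW//; [rewrite mulrCA -adm_fact | case: ag].
Qed.

Lemma Mg_ev K g t : adm g -> (t < K)%N -> Mg K g (ev t) = hell t * (1 + heps g t.+1).
Proof.
move=> ag tK; have tK' : (t.+1 < K.+1)%N by [].
rewrite (@Mg_hpow1 _ _ _ (Ordinal tK')) //; last exact: vexp_ev.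
by rewrite powRr0 hcst1 mul1r.
Qed.

Section Hom.
Variables (K : nat) (h : hahn).
Hypothesis ah : adm h.
Let wT := monoid_gen_eps_wo K ah.
Let MT := shifted_Mg (K := K) ah.
Local Notation C := (hcomp K h).

Lemma hcompE f e : C f e = \sum_(x \in [set: G]) f x * Mg K h x e.
Proof. by rewrite hcomp.unlock; exact: hlinE wT MT _ _. Qed.
Lemma hcompD f g : C (f + g) = C f + C g. Proof. by rewrite hcomp.unlock; exact: hlinD wT MT _ _. Qed.
Lemma hcompB f g : C (f - g) = C f - C g. Proof. by rewrite hcomp.unlock; exact: hlinB wT MT _ _. Qed.
Lemma hcompZ a f : C (hcst a * f) = hcst a * C f. Proof. by rewrite hcomp.unlock; exact: hlinZ wT MT _ _. Qed.
Lemma hcomp_hmono x : C (hmono x) = Mg K h x. Proof. by rewrite hcomp.unlock; exact: hlin_hmono wT MT _. Qed.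
Lemma hcomp1 : C 1 = 1. Proof. by rewrite hcomp.unlock; exact: hlin1 wT MT (Mg0 K ah). Qed.
Lemma hcomp_hcst a : C (hcst a) = hcst a. Proof. by rewrite hcomp.unlock; exact: hlin_hcst wT MT (Mg0 K ah) _. Qed.
Lemma hcompM f g : C (f * g) = C f * C g.
Proof. by rewrite hcomp.unlock; exact: (hlinM wT MT (fun x y => MgD K x y ah)). Qed.
Lemma hcomp_prod (I : Type) (r : seq I) (F : I -> hahn) :
  C (\prod_(i <- r) F i) = \prod_(i <- r) C (F i).
Proof. by rewrite hcomp.unlock; exact: (hlin_prod wT MT (Mg0 K ah) (fun x y => MgD K x y ah)). Qed.

Lemma ldt_hcomp x a f : ldt x a f -> ldt x (a * h ez `^ x.1) (C f).
Proof.
move=> [f0 fx].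
have -> : a * h ez `^ x.1 = \sum_(y \in [set: G]) (if y == x then a * h ez `^ x.1 else 0).
  by rewrite (@fsum1 _ _ _ x) ?eqxx// => y /negbTE ->.
apply: (@ldt_fsum _ _ (fun y => hcst (f y) * Mg K h y)).
  by move=> e; rewrite hcompE; apply: eq_fsbigr => y _; rewrite hvalZ.
move=> y; case: (ltgtP y x) => [/f0 -> | xy | ->].
- by rewrite hcst0 mul0r; apply: ldt00.
- exact: ldt_lt xy (ldtZ _ (ldt_Mg _ _ _)).
- by rewrite -fx; apply: ldtZ; apply: ldt_Mg.
Qed.

Lemma pos_hcomp f : pos f -> pos (C f).
Proof. by move=> /ldt_hcomp; rewrite mul0r. Qed.

Lemma hcomp_pw c u : pos u -> C (pw c u) = pw c (C u).
Proof.
move=> pu; have := pos_hcomp pu; rewrite hcomp.unlock.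
exact: (hlin_pw wT MT (Mg0 K ah) (fun x y => MgD K x y ah) c pu).
Qed.

Lemma ldt_hcomp_adm g : adm g -> ldt ez (g ez * h ez) (C g).
Proof.
by move=> /adm_ldt/ldt_hcomp; rewrite powRr1 // ltW //; case: ah.
Qed.

Lemma adm_hcomp g : adm g -> adm (C g).
Proof.
move=> ag; apply: adm_of_ldt (ldt_hcomp_adm ag).
by apply: mulr_gt0; [case: ag|case: ah].
Qed.

Lemma hcomp_ez g : adm g -> C g ez = g ez * h ez.
Proof. by move=> /ldt_hcomp_adm[]. Qed.

(** Chain rule for relative changes: [1 + heps g t] is [(v o g) / v] for the [t]-th variable [v], up
    to the leading coefficient when [v = z], and [(v o g o h) / v] is [(v o h) / v] times
    [((v o g) / v) o h]. The induction follows the recursion of [heps]; [t <= K] keeps the variable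
    within the truncation. *)
Lemma heps_hcomp g t : adm g -> (t <= K)%N ->
  heps (C g) t = heps h t + C (heps g t) + heps h t * C (heps g t).
Proof.
move=> ag; have aCg := adm_hcomp ag.
have [g0 h0] : 0 < g ez /\ 0 < h ez by case: ag ah => ? ? [].
suff H : (t <= K)%N -> 1 + heps (C g) t = (1 + heps h t) * (1 + C (heps g t)).
  by move=> /H E; apply: (addrI 1); rewrite E; ring.
elim: t => [_|t IH tK].
  have E1 : hcst (C g ez) * (hmono ez * (1 + heps (C g) 0)) =
      hcst (C g ez) * (hmono ez * ((1 + heps h 0) * (1 + C (heps g 0)))).
    rewrite -adm_fact // [in LHS](adm_fact ag) hcompZ hcompM hcomp_hmono Mg_ez //.
    rewrite hcompD hcomp1 hcomp_ez // hcstM.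
    transitivity (hcst (g ez) * (hcst (h ez) * (hmono ez * (1 + heps h 0)) *
      (1 + C (heps g 0)))); first by rewrite -adm_fact.
    by ring.
  have inv : hcst (C g ez)^-1 * hmono (- ez) * (hcst (C g ez) * hmono ez) = 1.
    rewrite mulrACA -hcstM -hmonoD addNr hmono0 mulVf ?mulr1//.
    by rewrite gt_eqF //; case: aCg.
  have := congr1 (fun p => hcst (C g ez)^-1 * hmono (- ez) * p) E1.
  have assoc (p q r s x : hahn) : p * q * (r * (s * x)) = (p * q * (r * s)) * x by ring.
  by rewrite !assoc inv !mul1r.
have {}IH := IH (ltnW tK).
have pe := pos_heps t ah; have pg := pos_heps t ag.
have E : heps (C g) t = heps h t + C (heps g t) + heps h t * C (heps g t).
  by apply: (addrI 1); rewrite IH; ring.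
(* The logarithms of the two factors add up, and so do the constants, by
   [ln (a b) = ln a + ln b]. *)
have EL : hL (C g) t = hL h t + C (hL g t).
  rewrite /hL E hlogM //; last exact: pos_hcomp.
  rewrite hcompD hcomp_hcst -[hlog (C _)]hcomp_pw // hcomp_ez // -/(hlog (heps g t)).
  have -> : (if t == 0%N then ln (g ez * h ez) else 0) =
      (if t == 0%N then ln (h ez) else 0) + (if t == 0%N then ln (g ez) else 0).
    by case: ifP => _; rewrite ?addr0 // lnM ?posrE // addrC.
  by rewrite hcstD; ring.
have P1 := hgeomM (pos_ellL (pos_heps t aCg)).
have P2 := hgeomM (pos_ellL pe).
have P3 : (1 - Mg K h (ev t) * C (hL g t)) * C (hgeom (hell t * hL g t)) = 1.
  by rewrite -hcomp_hmono -hcompM -[X in X - _]hcomp1 -hcompB -hcompM hgeomM ?hcomp1 //;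
    apply: pos_ellL.
have -> : 1 + C (heps g t.+1) = C (hgeom (hell t * hL g t)).
  by rewrite -(heps1 g t) [RHS]hcompD hcomp1.
rewrite (heps1 (C g) t).
rewrite (heps1 h t).
move: P3; rewrite (Mg_ev ah tK).
rewrite (heps1 h t).
move: P1 P2; rewrite EL.
move: (C (hgeom (hell t * hL g t))) => D.
move: (hgeom (hell t * (hL h t + C (hL g t)))) (hgeom (hell t * hL h t)) => X H.
move: (hell t) (hL h t : hahn) (C (hL g t)) => l A B P1 P2 P3.
(* With [(1 - l A) H = 1] and [(1 - l H B) D = 1], the product [H D] inverts [1 - l (A + B)], as [X]
   does. *)
have PY : (1 - l * (A + B)) * (H * D) = 1.
  transitivity ((1 - l * A) * H * D - l * H * B * D); first by ring.
  by rewrite P2 -[RHS]P3; ring.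
have -> : X = X * ((1 - l * (A + B)) * (H * D)) by rewrite PY mulr1.
by rewrite mulrA [X * _]mulrC P1 mul1r.
Qed.

Lemma Mg_hcomp g x : adm g -> C (Mg K g x) = Mg K (C g) x.
Proof.
move=> ag; rewrite (MgE K g) hcompM hcompZ hcomp_hmono hcomp_prod.
rewrite (MgE K h) (MgE K (C g)) hcomp_ez // powRM ?ltW//; [|by case: ag|by case: ah].
rewrite [in RHS](eq_bigr (fun t : 'I_K.+1 =>
  hpow (heps h t) (vexp x t) * C (hpow (heps g t) (vexp x t)))).
  by rewrite big_split hcstM /=; ring.
move=> t _; have tK : (t <= K)%N by rewrite -ltnS.
have pe := pos_heps t ah; have pg := pos_heps t ag.
by rewrite heps_hcomp // hpowM ?hcomp_pw //; apply: pos_hcomp.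
Qed.

Lemma hcompA f g : adm g -> C (hcomp K g f) = hcomp K (C g) f.
Proof.
move=> ag; transitivity (hlin (fun x => C (Mg K g x)) f).
  rewrite hcomp.unlock.
  exact: (hlin_comp _ (monoid_gen_eps_wo K ag) wT (shifted_Mg ag) MT).
have -> : (fun x => C (Mg K g x)) = Mg K (C g) by apply/funext => x; apply: Mg_hcomp.
exact/esym/hcomp_hlin.
Qed.

End Hom.
End Composition.

(** * Comparison with the expanded composition *)

Section RawComposition.
Variable R : realType.
Local Notation G := (expo R).
Local Notation hahn := (hahn R).
Local Notation ez := (e_z R).
Implicit Types (f g h u v w : hahn) (e x y : G) (a b : R) (t K N : nat) (s : seq nat)
  (A : set G) (E : nat -> hahn) (c : nat -> nat -> R).

Lemma finite_seq_sumn N B : finite_set [set s : seq nat | (size s <= N)%N /\ (sumn s <= B)%N].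
Proof.
elim: N => [|N IH].
  apply: sub_finite_set (finite_set1 [::]) => s [/=].
  by rewrite leqn0 => /nilP.
have fP : finite_set (`I_B.+1 `*` [set s : seq nat | (size s <= N)%N /\ (sumn s <= B)%N]).
  exact: finite_setX (finite_II _) IH.
have : finite_set ([set [::]] `|` (fun p => p.1 :: p.2) @`
    (`I_B.+1 `*` [set s : seq nat | (size s <= N)%N /\ (sumn s <= B)%N])).
  by rewrite finite_setU; split=> //; apply: finite_image.
apply: sub_finite_set => -[|n s] /= [sN sB]; first by left.
right; exists (n, s) => //=; split=> /=; last split=> //.
  by rewrite ltnS (leq_trans _ sB) // leq_addr.
by rewrite (leq_trans _ sB) // leq_addl.
Qed.

Lemma finite_nat_bound (F : set nat) : finite_set F -> exists B, forall n, F n -> (n <= B)%N.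
Proof.
move=> fF; exists (\max_(i <- finmap.enum_fset (fset_set F)) i)%N => n Fn.
by rewrite (@leq_bigmax_seq _ _ xpredT id) //; rewrite in_fset_set // inE.
Qed.

Lemma hmul_hsum (I : choiceType) (F : I -> hahn) f :
  strongly_summable (fun i => F i : ser R) ->
  strongly_summable (fun i => F i * f : ser R) /\ hsum F * f = hsum (fun i => F i * f).
Proof.
move=> sF; have [] := slin_tsum (hahn_wo f) (@shifted_translate _ f) sF.
have -> : (fun i => slin (translate f) (F i)) = (fun i => F i * f : ser R).
  by apply/funext => i; rewrite -smulE.
move=> sS E; split=> //; apply: hahn_ext => e.
rewrite (hsum_val sS) -E -[hsum F * f : ser R]/(smul (hsum F) f) smulE.
by rewrite (hsum_val sF).
Qed.

Definition mexp (E : nat -> hahn) s : hahn := \prod_(t < size s) E t ^+ nth 0%N s t.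
Definition mcoef (c : nat -> nat -> R) s : R := \prod_(t < size s) c t (nth 0%N s t).
(** The condition on the last entry makes each finitely supported multi-index occur once; all other
    sequences receive the term 0. *)
Definition mterm N (E : nat -> hahn) (c : nat -> nat -> R) s : hahn :=
  if (last 1%N s != 0%N) && (size s <= N)%N then hcst (mcoef c s) * mexp E s else 0.

Lemma mexp_supp A N E s : (forall t, (t < N)%N -> supp (E t) `<=` A) ->
  (size s <= N)%N -> supp (mexp E s) `<=` nsum A (sumn s).
Proof.
elim: s N E => [|n s IH] [|N] E EA //= sN.
- by rewrite /mexp big_ord0 -(expr0 0); apply: exprn_supp => e; rewrite /supp /= eqxx.
- by rewrite /mexp big_ord0 -(expr0 0); apply: exprn_supp => e; rewrite /supp /= eqxx.
rewrite /mexp big_ord_recl => e /mul_supp[x [y [hx hy ->]]]; apply: nsum_add.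
  by apply: exprn_supp hx; apply: EA.
apply: (IH N (fun t => E t.+1)) => // t tN.
exact: EA.
Qed.

Lemma mexp_degree_bound N E e : (forall t, (t < N)%N -> pos (E t)) -> exists B, forall s,
  (size s <= N)%N -> mexp E s e != 0 -> (sumn s <= B)%N.
Proof.
move=> pE; pose A := [set e | exists2 t, (t < N)%N & E t e != 0].
have A0 x : A x -> 0 < x by move=> [t tN]; apply: (posP _).1; apply: pE.
have wA : well_ordered A by apply: well_ordered_supp_family.
have [B hB] := finite_nat_bound (finite_nsum e wA A0); exists B => s sN hs; apply: hB.
by apply: (mexp_supp (N := N)) hs => // t tN x Etx; exists t.
Qed.

Lemma mterm_neq0 N E c s e : mterm N E c s e != 0 ->
  [/\ last 1%N s != 0%N, (size s <= N)%N & mexp E s e != 0].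
Proof.
rewrite /mterm; case: ifP => [/andP[ls sN]|_]; last by rewrite hval0 eqxx.
by rewrite hvalZ mulf_eq0 negb_or => /andP[].
Qed.

Lemma mterm_finite N E c e : (forall t, (t < N)%N -> pos (E t)) ->
  finite_set [set s | mterm N E c s e != 0].
Proof.
move=> pE; have [B hB] := mexp_degree_bound e pE.
by apply: sub_finite_set (finite_seq_sumn N B) => s /mterm_neq0[_ sN /(hB _ sN)].
Qed.

Lemma summable_mterm N E c : (forall t, (t < N)%N -> pos (E t)) ->
  strongly_summable (fun s => mterm N E c s : ser R).
Proof.
move=> pE; split=> [e|]; first exact: mterm_finite.
pose A := [set e | exists2 t, (t < N)%N & E t e != 0].
have A0 x : A x -> 0 < x by move=> [t tN]; apply: (posP _).1; apply: pE.
have wA : well_ordered A by apply: well_ordered_supp_family.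
apply: well_ordered_sub (well_ordered_monoid_gen wA A0) => e [s /mterm_neq0[_ sN hs]].
by exists (sumn s); apply: (mexp_supp (N := N)) hs => // t tN x Etx; exists t.
Qed.

(** Prepends the exponent of the first variable. The pair [([::], 0)] must give [[::]], since
    [[:: 0]] ends in a zero. *)
Definition norm_cons (p : seq nat * nat) : seq nat :=
  if (p.2 == 0%N) && nilp p.1 then [::] else p.2 :: p.1.

Lemma norm_cons_bij N : set_bij [set p | last 1%N p.1 != 0%N /\ (size p.1 <= N)%N]
  [set s | last 1%N s != 0%N /\ (size s <= N.+1)%N] norm_cons.
Proof.
split.
- move=> [[|m s] [|n]] /= [ls sN]; rewrite /norm_cons //=.
- move=> [[|m s] [|n]] [[|m' s'] [|n']]; rewrite /norm_cons //= => _ _.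
  + by move=> [->].
  + by move=> [-> ->].
  + by move=> [-> -> ->].
- move=> [|n [|m s]] /= [ls sN].
  + by exists ([::], 0%N).
  + by exists ([::], n) => //=; rewrite /norm_cons /=; case: n ls {sN}.
  + by exists (m :: s, n) => //=; rewrite /norm_cons andbF.
Qed.

Lemma mterm_norm_cons N E c s n : (forall t, c t 0%N = 1) ->
  last 1%N s != 0%N -> (size s <= N)%N ->
  mterm N.+1 E c (norm_cons (s, n)) =
  mterm N (fun t => E t.+1) (fun t => c t.+1) s * (hcst (c 0%N n) * E 0%N ^+ n).
Proof.
move=> c0 ls sN; rewrite /mterm ls sN /= /norm_cons /=.
case: (boolP ((n == 0%N) && nilp s)) => [/andP[/eqP-> /nilP ->]|ns].
  by rewrite /= /mcoef /mexp !big_ord0 c0 hcst1 expr0 !mulr1.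
have -> : last n s != 0%N.
  by case: s ls ns {sN} => //=; rewrite andbT.
rewrite /= ltnS sN /mcoef /mexp !big_ord_recl /= hcstM; ring.
Qed.

(** Expansion of a product of power series over multi-indices. The induction splits off the first
    factor, and [norm_cons] matches pairs of a tail and a head with multi-indices. *)
Lemma prod_pw_hsum N E c : (forall t, (t < N)%N -> pos (E t)) -> (forall t, c t 0%N = 1) ->
  \prod_(t < N) pw (c t) (E t) = hsum (mterm N E c).
Proof.
elim: N E c => [|N IH] E c pE c0; apply: hahn_ext => e.
  rewrite big_ord0 hsumE; last exact: summable_mterm.
  rewrite (@fsum1 _ _ _ [::]) => [|s].
    rewrite (_ : mterm 0 E c [::] = hcst (mcoef c [::]) * mexp E [::]) //.
    by rewrite /mcoef /mexp !big_ord0 hcst1 mul1r.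
  by case: s => [//|n s] _; rewrite /mterm andbF.
have pE' t : (t < N)%N -> pos (E t.+1) by move=> tN; apply: (pE t.+1).
have pE0 : pos (E 0%N) by apply: (pE 0%N).
rewrite big_ord_recl.
rewrite (IH (fun t => E t.+1) (fun t => c t.+1)) // mulrC.
set F := mterm N _ _; have sF : strongly_summable (fun s => F s : ser R) by apply: summable_mterm.
have [sFP ->] := hmul_hsum (pw (c 0%N) (E 0%N)) sF.
rewrite hsumE // hsumE; last exact: summable_mterm.
pose tm s n := (F s * (hcst (c 0%N n) * E 0%N ^+ n)) e.
rewrite (eq_fsbigr (fun s => \sum_(n \in [set: nat]) tm s n)); last first.
  move=> s _; rewrite mulrC /pw.
  have [sG ->] := hmul_hsum (F s) (summable_pw (c 0%N) pE0).
  by rewrite hsumE //; apply: eq_fsbigr => n _; rewrite /tm mulrC.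
have [B hB] := mexp_degree_bound e pE.
pose Sq := [set s : seq nat | (size s <= N)%N /\ (sumn s <= B)%N].
have tm_norm s n : tm s n != 0 -> last 1%N s != 0%N /\ (size s <= N)%N.
  rewrite /tm /F /mterm; case: ifP => [/andP[]//|_].
  by rewrite mul0r hval0 eqxx.
have tmE s n : last 1%N s != 0%N /\ (size s <= N)%N ->
    tm s n = mterm N.+1 E c (norm_cons (s, n)) e.
  by move=> [ls sN]; rewrite mterm_norm_cons.
(* The total degree of the terms reaching [e] is bounded by [B], which confines the double sum to a
   finite box. *)
have box s n : tm s n != 0 -> Sq s /\ `I_B.+1 n.
  move=> tsn; have D := tm_norm _ _ tsn; move: tsn; rewrite tmE //.
  case: D => ls sN /mterm_neq0[_ sz /(hB _ sz)].
  rewrite /norm_cons; case: ifP => [/andP[/= /eqP -> /nilP ->] _|_ /= sB]; first by [].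
  split=> /=; last by rewrite ltnS (leq_trans _ sB) // leq_addr.
  by split=> //; rewrite (leq_trans _ sB) // leq_addl.
rewrite -(fsum_pair (finite_seq_sumn N B) (finite_II B.+1) box).
rewrite [RHS](@fsum_support _ _ _ [set s | last 1%N s != 0%N /\ (size s <= N.+1)%N]); last first.
  by move=> s /mterm_neq0[].
rewrite (reindex_fsbig _ _ _ _ (norm_cons_bij N)).
rewrite [LHS](@fsum_support _ _ _ [set p | last 1%N p.1 != 0%N /\ (size p.1 <= N)%N]).
  by apply: eq_fsbigr => -[s n] /set_mem /= D; rewrite tmE.
by move=> [s n] /tm_norm.
Qed.

(** Depth at most [K]: index [j] stands for [l_(j+1)], so only [l_1, ..., l_K] may occur. *)
Definition bounded K (f : ser R) := forall e, f e != 0 -> forall j, (K <= j)%N -> e.2 j = 0.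

Lemma gbinom0 a : gbinom a 0 = 1 :> R.
Proof. by rewrite /gbinom big_ord0 fact0 divr1. Qed.

Lemma gbinom0S n : gbinom (0 : R) n.+1 = 0.
Proof. by rewrite /gbinom big_ord_recl subrr !mul0r. Qed.

(** The last entry [n > 0] sits on a variable of exponent 0 in [x], and [binom(0, n) = 0]. Long
    multi-indices thus contribute nothing to [compose]. *)
Lemma mcoef_long K x s : (forall j, (K <= j)%N -> x.2 j = 0) ->
  last 1%N s != 0%N -> (K.+1 < size s)%N -> mcoef (fun t => gbinom (vexp x t)) s = 0.
Proof.
case/lastP: s => [//|s n] xK; rewrite last_rcons size_rcons ltnS => n0 Ks.
rewrite /mcoef size_rcons big_ord_recr /= nth_rcons ltnn eqxx.
rewrite (_ : vexp x (size s) = 0); first by case: n n0 => // n _; rewrite gbinom0S mulr0.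
by case: (size s) Ks => // m Km; rewrite /vexp xK.
Qed.

(** As [compose] does not mention [K], this also serves to change the truncation level. *)
Lemma compose_hcomp K f g : adm g -> bounded K f -> compose f g = hcomp K g f.
Proof.
move=> ag bf; apply/funext => e; rewrite hcompE // /compose /tsum.
have pE t : (t < K.+1)%N -> pos (heps g t) by move=> _; apply: pos_heps.
pose c x t := gbinom (vexp x t : R).
pose F x s := mterm K.+1 (heps g) (c x) s.
have sF x : strongly_summable (fun s => F x s : ser R) by apply: summable_mterm.
pose tm x s := f x * (g ez `^ x.1 * F x s (e - x)).
have ctermE x s : cterm f g (x, s) e =
    f x * (g ez `^ x.1 * (mcoef (c x) s * mexp (heps g) s (e - x))).
  rewrite /cterm /sscale /=.
  have -> : \big[@smul R/Defs.cst 1]_(t < size s) spow (eps g t) (nth 0%N s t) =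
      mexp (heps g) s :> ser R.
    rewrite (big_morph (fun h : hahn => h : ser R) (id1 := Defs.cst 1) (op1 := @smul R)) //.
    by apply: eq_bigr => t _; rewrite eps_val // spowE.
  rewrite -[smul _ _]/(hmono x * mexp (heps g) s : ser R) hmonoM /mcoef /c /lead.
  by rewrite !mulrA.
have fMgE x : f x * Mg K g x e = \sum_(s \in [set: seq nat]) tm x s.
  rewrite MgE hmonoM hvalZ.
  rewrite (prod_pw_hsum (c := c x) pE) => [|t]; last exact: gbinom0.
  by rewrite hsumE; [rewrite !mulr_fsumr | exact: sF].
rewrite [RHS](eq_fsbigr (fun x => \sum_(s \in [set: seq nat]) tm x s)); last first.
  by move=> x _; apply: fMgE.
pose A := eps_supp K g.
pose X := [set x | f x != 0 /\ monoid_gen A (e - x)].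
have fX : finite_set X.
  apply: finite_decomposition; first exact: hahn_wo.
  exact: monoid_gen_eps_wo.
pose S := \bigcup_(x in X) [set s | F x s (e - x) != 0].
have fS : finite_set S by apply: bigcup_finite => // x _; apply: mterm_finite.
have box x s : tm x s != 0 -> X x /\ S s.
  rewrite /tm !mulf_eq0 !negb_or => /and3P[fx _ Fs].
  have Xx : X x.
    split=> //; have [_ sz hs] := mterm_neq0 Fs; exists (sumn s).
    apply: (mexp_supp (N := K.+1)) hs => // t tK y hy.
    by exists t.
  by split=> //; exists x.
rewrite -(fsum_pair fX fS box).
rewrite [RHS](@fsum_support _ _ _ [set p | f p.1 != 0 /\ last 1%N p.2 != 0%N]).
  apply: eq_fsbigr => -[x s] /set_mem /= [fx ls]; rewrite ctermE /tm /F /mterm ls /=.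
  case: ifP => sK; first by rewrite hvalZ.
  rewrite hval0 (@mcoef_long K) ?mul0r//; last by rewrite ltnNge sK.
  exact: bf fx.
move=> [x s]; rewrite /= /tm !mulf_eq0 !negb_or => /and3P[fx _].
by move=> /mterm_neq0[].
Qed.

End RawComposition.

(** * Depth, and equations with prescribed leading terms *)

Section Bounded.
Variable R : realType.
Local Notation G := (expo R).
Local Notation hahn := (hahn R).
Local Notation ez := (e_z R).
Variable K : nat.
Implicit Types (f g h u v w : hahn) (e x y : G) (a b : R) (t : nat).

Definition ebounded : set G := [set e | forall j, (K <= j)%N -> e.2 j = 0].

Lemma eboundedD x y : ebounded x -> ebounded y -> ebounded (x + y).
Proof. by move=> bx yb j Kj; rewrite -[LHS]/(x.2 j + y.2 j) bx // yb. Qed.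

Lemma eboundedN x : ebounded x -> ebounded (- x).
Proof. by move=> bx j Kj; rewrite -[LHS]/(- x.2 j) bx // oppr0. Qed.

Lemma bounded_hmono x : ebounded x -> bounded K (hmono x).
Proof.
move=> bx e; rewrite hmonoE; have [->|_] := eqVneq e x; first by [].
by rewrite eqxx.
Qed.

Lemma bounded_hcst a : bounded K (hcst a).
Proof. by move=> e; rewrite hcstE; have [->|_] := eqVneq e 0; rewrite ?eqxx. Qed.
Arguments bounded_hcst : clear implicits.

Lemma boundedD f g : bounded K f -> bounded K g -> bounded K (f + g).
Proof.
move=> bf bg e; rewrite hvalD; have [->|fe _] := eqVneq (f e) 0; last exact: bf.
by rewrite add0r => /bg.
Qed.

Lemma boundedN f : bounded K f -> bounded K (- f).
Proof. by move=> bf e; rewrite hvalN oppr_eq0 => /bf. Qed.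

Lemma boundedB f g : bounded K f -> bounded K g -> bounded K (f - g).
Proof. by move=> bf /boundedN; apply: boundedD. Qed.

Lemma boundedM f g : bounded K f -> bounded K g -> bounded K (f * g).
Proof. by move=> bf bg e /mul_supp[x [y [/bf bx /bg yb ->]]]; apply: eboundedD. Qed.

Lemma bounded_prod (I : Type) (r : seq I) (F : I -> hahn) :
  (forall i, bounded K (F i)) -> bounded K (\prod_(i <- r) F i).
Proof.
move=> bF; apply: (big_ind (fun f : hahn => bounded K f)) => //.
- exact: bounded_hcst.
- exact: boundedM.
Qed.

Lemma bounded_pw c f : pos f -> bounded K f -> bounded K (pw c f).
Proof.
move=> pf bf e /(@pw_supp _ c ebounded f pf bf)[n]; elim: n e => [e -> //|n IH e].
by move=> [x [y [bx /IH yb ->]]]; apply: eboundedD.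
Qed.

(** Besides the variables of [g], [heps g t] involves [l_1, ..., l_t], whence [t <= K]. *)
Lemma bounded_heps g t : adm g -> bounded K g -> (t <= K)%N -> bounded K (heps g t).
Proof.
move=> ag bg; elim: t => [_|t IH tK].
  rewrite heps0; apply: boundedB _ (bounded_hcst 1); apply: boundedM (bounded_hcst _) _.
  apply: boundedM _ bg; apply: bounded_hmono; exact: eboundedN.
have {}IH := IH (ltnW tK); have pe := pos_heps t ag.
rewrite hepsS; apply: boundedB _ (bounded_hcst 1); apply: bounded_pw; first exact: pos_ellL.
apply: boundedM.
  by apply: bounded_hmono => j Kj /=; rewrite gtn_eqF // (leq_trans tK).
by apply: boundedD; [apply: bounded_hcst|apply: bounded_pw].
Qed.

Lemma bounded_Mg g x : adm g -> bounded K g -> ebounded x -> bounded K (Mg K g x).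
Proof.
move=> ag bg bx; rewrite MgE; apply: boundedM; first exact: bounded_hmono.
apply: boundedM (bounded_hcst _) _; apply: bounded_prod => t.
apply: bounded_pw; first exact: pos_heps.
by apply: bounded_heps => //; rewrite -ltnS.
Qed.

Lemma bounded_hcomp g f : adm g -> bounded K g -> bounded K f -> bounded K (hcomp K g f).
Proof.
move=> ag bg bf e; rewrite hcompE // => /fsum_neq0[x _].
rewrite mulf_eq0 negb_or => /andP[/bf bx].
exact: bounded_Mg.
Qed.

End Bounded.

Section Solver.
Variable R : realType.
Local Notation G := (expo R).
Local Notation hahn := (hahn R).
(** A perturbation [a e] of the argument changes [E] by [c e * a] at [tau e]. Used for the
    conjugation equation, and with [tau = id] for inverses. *)
Variables (A B : set G) (tau : G -> G) (c : G -> R) (E : hahn -> hahn).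
Hypotheses (tau_surj : forall y, B y -> exists2 e, A e & tau e = y)
  (tau_mono : forall x y, A x -> A y -> x < y -> tau x < tau y)
  (cN0 : forall e, A e -> c e != 0)
  (E_supp : forall u : hahn, supp u `<=` A -> supp (E u) `<=` B)
  (E_ldt : forall (u v : hahn) e a, supp u `<=` A -> supp v `<=` A -> A e ->
     ldt e a (u - v) -> ldt (tau e) (c e * a) (E u - E v)).
Implicit Types (u v : hahn) (e x y : G).

(** A partial solution up to [e]; excluding terms beyond [e] makes it unique for that [e]. *)
Let good e u := [/\ A e, supp u `<=` A, forall x, u x != 0 -> x <= e &
  forall y, y <= tau e -> E u y = 0].

Let tau_le x y : A x -> A y -> x <= y -> tau x <= tau y.
Proof.
move=> Ax Ay; rewrite le_eqVlt => /orP[/eqP->//|/(tau_mono Ax Ay)].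
exact: ltW.
Qed.

Let suppB u v : supp u `<=` A -> supp v `<=` A -> supp (u - v) `<=` A.
Proof.
move=> uA vA e; rewrite /supp /mkset hvalB.
have [ue|/uA//] := eqVneq (u e) 0.
by rewrite ue sub0r oppr_eq0 => /vA.
Qed.

(** A first difference at [y <= e] would show in [E u - E v] at [tau y], where both values
    vanish. *)
Let good_unique e e' u v : good e u -> good e' v -> e <= e' ->
  forall x, x <= e -> u x = v x.
Proof.
move=> [Ae uA ue Eu] [Ae' vA ve Ev] ee'.
have [uv|] := eqVneq (u - v) 0.
  by move=> x _; apply/eqP; rewrite -subr_eq0 -hvalB uv.
move=> /ldt_exists[y [uvy uvl]] x xe; apply/eqP; apply/negPn/negP => uvx.
have yx : y <= x by apply: (ldt_supp_ge uvl); rewrite hvalB subr_eq0.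
have Ay : A y by apply: (suppB uA vA).
have [_] := E_ldt uA vA Ay uvl; rewrite hvalB Eu ?Ev.
- by rewrite subrr => /esym/eqP; rewrite mulf_eq0 (negbTE uvy) (negbTE (cN0 Ay)).
- by apply: tau_le => //; apply: le_trans (le_trans yx xe) ee'.
- by apply: tau_le => //; apply: le_trans yx xe.
Qed.

(* The solution is the union of all partial solutions: two of them agree where
   both are defined, and the union can be extended as long as it does not
   solve the equation. *)
Lemma solver : exists2 u : hahn, supp u `<=` A & E u = 0.
Proof.
pose P x (r : R) := exists e u, [/\ good e u, x <= e & u x = r].
have PP x r r' : P x r -> P x r' -> r = r'.
  move=> [e [u [gu xe <-]]] [e' [v [gv xe' <-]]].
  case/orP: (le_total e e') => ee.
    exact: good_unique gu gv ee _ xe.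
  by apply/esym; apply: good_unique gv gu ee _ xe'.
pose Psi x : R := xget 0 (P x).
have PsiE e u x : good e u -> x <= e -> Psi x = u x.
  move=> gu xe; have Pu : P x (u x) by exists e, u.
  exact: PP (xgetI 0 Pu) Pu.
have PsiN0 x : Psi x != 0 -> exists e u, [/\ good e u, x <= e & u x != 0].
  rewrite /Psi; case: xgetP => [r _ [e [u [gu xe <-]]] ux|_]; last by rewrite eqxx.
  by exists e, u.
(* Below [e] the union coincides with a single partial solution, whose well-ordered support supplies
   the minimum. *)
have wPsi : well_ordered (supp Psi).
  apply/well_orderedP => D DP [x Dx].
  have [e [u [gu xe ux]]] := PsiN0 _ (DP _ Dx).
  have /well_orderedP/(_ (D `&` [set y | y <= e]))[] := hahn_wo u.
  - by move=> y [/DP Py /= ye]; rewrite /supp /mkset -(PsiE e u y gu ye).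
  - by exists x.
  move=> y [Dy /= ye] ymin; exists y => // z Dz.
  case: (leP z e) => ze; first by apply: ymin.
  exact: le_trans ye (ltW ze).
pose U := Hahn wPsi; have UA : supp U `<=` A.
  by move=> x /PsiN0[e [u [[_ uA _ _] _ /uA]]].
(* [U] and [u] first differ beyond [e], so [E U] and [E u] agree up to [tau e]. *)
exists U => //; have EU e u : good e u -> forall y, y <= tau e -> E U y = 0.
  move=> gu y ye; have [Ae uA ue Eu] := gu.
  have [Uu|] := eqVneq (U - u) 0.
    have -> : U = u by apply/eqP; rewrite -subr_eq0 Uu.
    exact: Eu.
  move=> /ldt_exists[z [Uuz Uul]].
  have Az : A z by apply: (suppB UA uA).
  have ez : e < z.
    rewrite ltNge; apply/negP => ze; move: Uuz.
    by rewrite hvalB -[U z]/(Psi z) (PsiE e u z) // subrr eqxx.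
  have [+ _] := E_ldt UA uA Az Uul => /(_ y).
  rewrite hvalB Eu // subr0; apply.
  exact: le_lt_trans ye (tau_mono Ae Az ez).
(* If [E U] had a leading exponent [m = tau e], every partial solution would stop before [e]; one
   more term at [e] would then give a partial solution up to [e], a contradiction. *)
apply/eqP; apply/negPn/negP => /ldt_exists[m [EUm EUl]].
have [e Ae te] := tau_surj (E_supp UA EUm).
have lte e' u : good e' u -> e' < e.
  move=> gu; have [Ae' _ _ _] := gu; rewrite ltNge; apply/negP => ee'.
  by move: EUm; rewrite (EU _ _ gu) ?eqxx// -te; apply: tau_le.
have Ult x : U x != 0 -> x < e.
  by move=> /PsiN0[e' [u [gu xe' _]]]; apply: le_lt_trans xe' (lte _ _ gu).
(* Chosen so that the change [c e * b] cancels the coefficient of [E U] at [m]. *)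
pose b := - E U m / c e.
pose V := U + hcst b * hmono e.
have Ve : ldt e b (V - U).
  rewrite /V [U + _]addrC addrK.
  by have := ldtZ b (ldt_hmono e); rewrite mulr1.
have VA : supp V `<=` A.
  move=> x; rewrite /supp /mkset hvalD hvalZ hmonoE.
  have [->//|_] := eqVneq x e.
  by rewrite mulr0 addr0 => /UA.
have [Ev0 Eve] := E_ldt VA UA Ae Ve.
suff gV : good e V by move: (lte _ _ gV); rewrite ltxx.
split=> // [x|y].
  rewrite hvalD hvalZ hmonoE; have [->//|_] := eqVneq x e.
  by rewrite mulr0 addr0 => /Ult/ltW.
rewrite le_eqVlt => /orP[/eqP->|yt].
  move: Eve; rewrite hvalB te /b mulrC divfK ?cN0// => /eqP.
  by rewrite subr_eq addNr => /eqP.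
move: (Ev0 _ yt); rewrite hvalB => /eqP; rewrite subr_eq0 => /eqP ->.
by apply: EUl.1; rewrite -te.
Qed.

End Solver.

(** * Leading terms of differences *)

Section Ones.
Variable R : realType.
Local Notation G := (expo R).
Local Notation ez := (e_z R).
Implicit Types (x y e : G) (i j k K : nat).

Definition ones k : G := (0, onek k).

Lemma ones0 : ones 0 = 0. Proof. by []. Qed.

Lemma onesS k : ones k + ev R k = ones k.+1.
Proof.
rewrite [LHS]surjective_pairing [RHS]surjective_pairing; congr pair; first exact: addr0.
apply/funext => j; rewrite -[LHS]/(onek k j + (if j == k then 1 else 0)) /= /onek ltnS.
by case: (ltngtP j k).
Qed.

Lemma ones_lt j k : (j < k)%N -> ones j < ones k.
Proof.
elim: k => // k IH; rewrite ltnS leq_eqVlt -onesS => h.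
have lk : ones k < ones k + ev R k by rewrite -[X in X < _]addr0 expo_ltD2l ev_gt0.
by case/orP: h => [/eqP->//|/IH/lt_trans]; apply.
Qed.

Lemma ones_le j k : (j <= k)%N -> ones j <= ones k.
Proof. by rewrite leq_eqVlt => /orP[/eqP->//|/ones_lt/ltW]. Qed.

Lemma ones_ge0 k : 0 <= ones k.
Proof. by rewrite -ones0 ones_le. Qed.

Lemma ebounded_ones K j : (j <= K)%N -> ebounded K (ones j).
Proof. by move=> jK i Ki; rewrite /= /onek ltnNge (leq_trans jK). Qed.

(* Junk value [0] if no logarithm occurs in [y]. *)
Definition first_log y : nat := xget 0%N [set j | (forall i, (i < j)%N -> y.2 i = 0) /\ y.2 j != 0].

Lemma first_log_eq y j : (forall i, (i < j)%N -> y.2 i = 0) -> y.2 j != 0 -> first_log y = j.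
Proof.
move=> h hj; apply: xget_unique => // k [h' hk]; case: (ltngtP k j) => // kj.
  by rewrite h ?eqxx in hk.
by rewrite h' ?eqxx in hj.
Qed.

Lemma first_logP K y : 0 < y -> y.1 = 0 -> ebounded K y ->
  [/\ (first_log y < K)%N, forall i, (i < first_log y)%N -> y.2 i = 0 &
      0 < y.2 (first_log y)].
Proof.
move=> /eltE[y0|[_ [j [h hj]]]] y1 yb; first by rewrite y1 ltxx in y0.
have hj' : y.2 j != 0 by rewrite gt_eqF.
have h' i : (i < j)%N -> y.2 i = 0 by move=> /h.
rewrite (first_log_eq h' hj'); split=> //.
by rewrite ltnNge; apply/negP => /yb /eqP; rewrite (negbTE hj').
Qed.

Lemma elt_lex x y j : x.1 = y.1 -> (forall i, (i < j)%N -> x.2 i = y.2 i) ->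
  x.2 j < y.2 j -> x < y.
Proof. by move=> xy h hj; apply/eltE; right; split=> //; exists j. Qed.

(** The leading exponent of [y o g - y] when [g = lam z + h.o.t.] with [lam] different from 1 and
    [y] is purely logarithmic. *)
Definition shift_log y := y + ones (first_log y).+1.

(** Before the first logarithm of [y] both sides have entries 1; there the left has 1 and the right
    more than 1. *)
Lemma shift_log_gt K y : 0 < y -> y.1 = 0 -> ebounded K y -> ones K < shift_log y.
Proof.
move=> y0 y1 yb; have [jK h hj] := first_logP y0 y1 yb; set j := first_log y in jK h hj *.
have E i : (shift_log y).2 i = y.2 i + onek j.+1 i by [].
apply: (@elt_lex _ _ j) => [|i ij|].
- by rewrite -[RHS]/(y.1 + 0) y1 addr0.
- by rewrite E h // /= /onek (ltn_trans ij jK) ltnS (ltnW ij).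
- by rewrite E /= /onek jK ltnSn -[X in X < _]add0r ltrD2r.
Qed.

(** If [y] starts at an earlier index than [x], the two shifts agree up to that index, which decides
    the comparison; if they start together, the shifts are equal. [y] cannot start later, being
    larger. *)
Lemma shift_log_lt K x y : 0 < x -> x.1 = 0 -> ebounded K x -> y.1 = 0 -> ebounded K y ->
  x < y -> shift_log x < shift_log y.
Proof.
move=> x0 x1 bx y1 yb xy; have y0 := lt_trans x0 xy.
have [iK hi xi] := first_logP x0 x1 bx; have [jK hj yj] := first_logP y0 y1 yb.
rewrite /shift_log; set i := first_log x in iK hi xi *; set j := first_log y in jK hj yj *.
case: (ltngtP j i) => ij.
- apply: (@elt_lex _ _ j) => [|l lj|].
  + by rewrite -[LHS]/(x.1 + 0) -[RHS]/(y.1 + 0) x1 y1.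
  + rewrite -[LHS]/(x.2 l + onek i.+1 l) -[RHS]/(y.2 l + onek j.+1 l) hi ?hj //.
      by rewrite /onek !ltnS (ltnW lj) (ltnW (ltn_trans lj ij)).
    exact: ltn_trans ij.
  + rewrite -[X in X < _]/(x.2 j + onek i.+1 j) -[X in _ < X]/(y.2 j + onek j.+1 j).
    by rewrite hi // /onek !ltnS leqnn (ltnW ij) ltrD2r.
- suff : y < x by move=> /(lt_trans xy); rewrite ltxx.
  apply: (@elt_lex _ _ i) => [|l li|]; first by rewrite x1 y1.
    by rewrite hi // hj // (ltn_trans li).
  by rewrite hj.
- by rewrite ij expo_ltD2r.
Qed.

(** The first entry of [y] exceeding 1 tells which product [l_1 ... l_(j+1)] to divide by. *)
Lemma shift_log_surj K y : y.1 = 0 -> ebounded K y -> ones K < y ->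
  exists x, [/\ 0 < x, x.1 = 0, ebounded K x & shift_log x = y].
Proof.
move=> y1 yb /eltE[|[_ [j [h hj]]]]; first by rewrite y1 ltxx.
have jK : (j < K)%N.
  rewrite ltnNge; apply/negP => Kj; move: hj.
  by rewrite yb // /= /onek ltnNge Kj ltxx.
move: hj; rewrite /= /onek jK => hj.
pose x := y - ones j.+1.
have xE i : x.2 i = y.2 i - onek j.+1 i by [].
have x1 : x.1 = 0 by rewrite -[x.1]/(y.1 - 0) y1 subr0.
have hx i : (i < j)%N -> x.2 i = 0.
  by move=> ij; rewrite xE -h // /= /onek (ltn_trans ij jK) ltnS (ltnW ij) subrr.
have xj : 0 < x.2 j by rewrite xE /onek ltnSn subr_gt0.
exists x; split=> //.
- by apply: (@elt_lex _ _ j) => // i ij; rewrite hx.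
- by apply: eboundedD yb _; apply: eboundedN; apply: ebounded_ones.
- by rewrite /shift_log (first_log_eq hx) ?subrK// gt_eqF.
Qed.

End Ones.

Section Differences.
Variable R : realType.
Local Notation G := (expo R).
Local Notation hahn := (hahn R).
Local Notation ez := (e_z R).
Implicit Types (f g h u v w : hahn) (e x y : G) (a b : R) (t K : nat).

Lemma ldt_hepsB g g' e a t : adm g -> adm g' ->
  ldt (e + ones R t) a (hL g t - hL g' t) ->
  ldt (e + ones R t.+1) a (heps g t.+1 - heps g' t.+1).
Proof.
move=> ag ag' h; rewrite !hepsS.
set p := hell _ t * hL g t; set q := hell _ t * hL g' t.
have pq : ldt (e + ones R t.+1) a (p - q).
  rewrite /p /q -mulrBr; apply: ldt_eq (ldt_shift (ev R t) h) _ _ => //.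
  by rewrite -onesS addrC addrA.
rewrite opprB addrA subrK.
have := ldt_pwB (@geom_coef R) (pos_ellL (pos_heps t ag)) (pos_ellL (pos_heps t ag')) pq.
by rewrite mul1r.
Qed.

Lemma ldt_hlogB u v e a : pos u -> pos v -> ldt e a (u - v) -> ldt e a (hlog u - hlog v).
Proof.
move=> pu pv uv; apply: ldt_eq (ldt_pwB (@log_coef R) pu pv uv) erefl _.
by rewrite /log_coef expr0 divr1 mul1r.
Qed.

(** To first order [heps g t.+1] is [l_(t+1)] times [hL g t], and a logarithm preserves leading
    differences; so each level contributes one more factor [l_(t+1)]. *)
Lemma ldt_hLB g g' e a t : adm g -> adm g' -> ldt e a (hL g 0 - hL g' 0) ->
  ldt (e + ones R t) a (hL g t - hL g' t).
Proof.
move=> ag ag' h; elim: t => [|t IH]; first by rewrite ones0 addr0.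
have hLS p : hL p t.+1 = hlog (heps p t.+1) by rewrite /hL hcst0 add0r.
rewrite !hLS.
by apply: ldt_hlogB; [apply: pos_heps|apply: pos_heps|apply: ldt_hepsB].
Qed.

Lemma ldt_hpow u a : pos u -> ldt 0 1 (hpow u a).
Proof. by move=> /(ldt_pw (gbinom a)); rewrite gbinom0. Qed.

Lemma gbinom1 a : gbinom a 1 = a.
Proof. by rewrite /gbinom big_ord1 subr0 divr1. Qed.

(* The contribution of [l_1, ..., l_N] to [(x o g) / x]. *)
Definition Qg N g x : hahn := \prod_(t < N) hpow (heps g t.+1) (vexp x t.+1).

Lemma ldt_Qg N g x : adm g -> ldt 0 1 (Qg N g x).
Proof.
move=> ag; apply: (big_ind (ldt 0 1)); first exact: ldt_hcst.
  by move=> f h f1 h1; have := ldtM f1 h1; rewrite addr0 mulr1.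
by move=> t _; apply: ldt_hpow; apply: pos_heps.
Qed.

(** Telescoping over the factors: those before [j] equal 1, the factor [j] contributes [a] times the
    exponent [x.2 j], and the later ones differ only at larger exponents. *)
Lemma ldt_QgB N g g' e a x j : adm g -> adm g' -> ldt e a (hL g 0 - hL g' 0) ->
  (forall i, (i < j)%N -> x.2 i = 0) ->
  ldt (e + ones R j.+1) (if (j < N)%N then a * (x.2 j)%:~R else 0) (Qg N g x - Qg N g' x).
Proof.
move=> ag ag' gg' xj; elim: N => [|N IH]; first by rewrite /Qg !big_ord0 subrr; apply: ldt00.
rewrite /Qg !big_ord_recr -!/(Qg N _ x) [vexp x _]/=.
set p := hpow _ _; set q := hpow _ _.
have -> : Qg N g x * p - Qg N g' x * q = (Qg N g x - Qg N g' x) * p + Qg N g' x * (p - q).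
  by move: (Qg _ _ _) (Qg _ _ _) p q => *; ring.
have pq : ldt (e + ones R N.+1) ((x.2 N)%:~R * a) (p - q).
  have := ldt_pwB (gbinom ((x.2 N)%:~R)) (pos_heps N.+1 ag) (pos_heps N.+1 ag')
    (ldt_hepsB ag ag' (ldt_hLB N ag ag' gg')).
  by rewrite gbinom1.
have p1 : ldt 0 1 p by apply: ldt_hpow; apply: pos_heps.
have := ldtM IH p1; rewrite addr0 mulr1 => IH1.
have := ldtM (ldt_Qg N x ag') pq; rewrite add0r mul1r => pq1.
rewrite ltnS; case: (ltngtP N j) => Nj.
- have -> : p - q = 0 by rewrite /p /q xj // !hpow0 ?subrr//; apply: pos_heps.
  by rewrite mulr0 addr0; move: IH1; rewrite ltnNge (ltnW Nj).
- rewrite -[X in ldt _ X]addr0; apply: ldtD; first by move: IH1; rewrite Nj.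
  apply: ldt_lt pq1; rewrite expo_ltD2l; exact: ones_lt.
- rewrite -[X in ldt _ X]add0r -Nj; apply: ldtD; first by move: IH1; rewrite -Nj ltnn.
  by rewrite [a * _]mulrC.
Qed.

Lemma Mg_Qg K g x : adm g -> x.1 = 0 -> Mg K g x = hmono x * Qg K g x.
Proof.
move=> ag x1; rewrite MgE x1 powRr0 hcst1 mul1r big_ord_recl [vexp x _]/= x1 hpow0 ?mul1r//.
exact: pos_heps.
Qed.

Lemma ldt_MgB K g g' e a x : adm g -> adm g' -> ldt e a (hL g 0 - hL g' 0) ->
  0 < x -> x.1 = 0 -> ebounded K x ->
  ldt (e + shift_log x) (a * (x.2 (first_log x))%:~R) (Mg K g x - Mg K g' x).
Proof.
move=> ag ag' gg' x0 x1 xb; have [jK h _] := first_logP x0 x1 xb.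
rewrite !Mg_Qg // -mulrBr.
have := ldt_shift x (ldt_QgB K ag ag' gg' h); rewrite jK => l.
by apply: ldt_eq l _ _ => //; rewrite /shift_log addrCA.
Qed.

Lemma hcompB_fsum K g g' f y : adm g -> adm g' ->
  (hcomp K g f - hcomp K g' f) y = \sum_(x \in [set: G]) (hcst (f x) * (Mg K g x - Mg K g' x)) y.
Proof.
move=> ag ag'.
have E x : (hcst (f x) * (Mg K g x - Mg K g' x)) y = f x * Mg K g x y - f x * Mg K g' x y.
  by rewrite hvalZ hvalB mulrBr.
rewrite [RHS](eq_fsbigr (fun x => f x * Mg K g x y - f x * Mg K g' x y)); last first.
  by move=> x _; apply: E.
rewrite fsumB.
- by rewrite hvalB (@hcompE _ K g ag f y) (@hcompE _ K g' ag' f y).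
- exact: (hlin_finite (@monoid_gen_eps_wo R K g ag) (@shifted_Mg R K g ag) f y).
- exact: (hlin_finite (@monoid_gen_eps_wo R K g' ag') (@shifted_Mg R K g' ag') f y).
Qed.

(** The constant term of [F0] is unaffected, and every other monomial is purely logarithmic and
    moved beyond [l_1 ... l_K] by [shift_log_gt]. *)
Lemma ldt_hcompB K g g' e a (F0 : hahn) : adm g -> adm g' -> ldt e a (hL g 0 - hL g' 0) ->
  bounded K F0 -> (forall x, F0 x != 0 -> x.1 = 0 /\ 0 <= x) ->
  ldt (e + ones R K) 0 (hcomp K g F0 - hcomp K g' F0).
Proof.
move=> ag ag' gg' bF F0x.
suff h x : ldt (e + ones R K) 0 (hcst (F0 x) * (Mg K g x - Mg K g' x)).
  apply: ldt_eq (ldt_fsum (fun y => hcompB_fsum K F0 y ag ag') h) _ _ => //.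
  exact: fsbig1.
have [->|Fx] := eqVneq (F0 x) 0; first by rewrite hcst0 mul0r; apply: ldt00.
have [x1] := F0x _ Fx; rewrite le_eqVlt => /orP[/eqP <-|x0].
  by rewrite !Mg0 // subrr mulr0; apply: ldt00.
have := ldtZ (F0 x) (ldt_MgB ag ag' gg' x0 x1 (bF _ Fx)).
by apply: ldt_lt; rewrite expo_ltD2l; apply: shift_log_gt => //; apply: bF.
Qed.

Definition hid : hahn := hmono ez.

Lemma ldt_hid : ldt ez 1 hid. Proof. exact: ldt_hmono. Qed.

Lemma adm_parabolic f : ldt ez 1 f -> adm f.
Proof. exact: adm_of_ldt ltr01. Qed.

Lemma adm_hid : adm hid. Proof. exact: adm_parabolic ldt_hid. Qed.

Lemma heps_hid t : heps hid t = 0.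
Proof.
elim: t => [|t IH].
  by rewrite heps0 ldt_hid.2 invr1 hcst1 mul1r -hmonoD addNr hmono0 subrr.
rewrite hepsS /hL ldt_hid.2 ln1 if_same hcst0 add0r IH /hlog pw0 [log_coef _ _]/= hcst0 mulr0.
by rewrite /hgeom pw0 hcst1 subrr.
Qed.

Lemma hL_hid : hL hid 0 = 0.
Proof. by rewrite /hL heps_hid ldt_hid.2 ln1 hcst0 add0r /hlog pw0 hcst0. Qed.

Lemma hcomp_hid K f : hcomp K hid f = f.
Proof.
have ME x : Mg K hid x = hmono x.
  rewrite MgE ldt_hid.2 powR1 hcst1 mul1r big1 ?mulr1// => t _.
  by rewrite heps_hid /hpow pw0 gbinom0.
apply: hahn_ext => e; rewrite hcompE; last exact: adm_hid.
rewrite (@fsum1 _ _ _ e) => [|x xe]; rewrite ME hmonoE ?eqxx ?mulr1//.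
by rewrite eq_sym (negbTE xe) mulr0.
Qed.

(** To first order [hL p 0 - hL q 0] is [(p - q) / z]. *)
Lemma ldt_hLB_parabolic p q e a : ldt ez 1 p -> ldt ez 1 q -> ldt e a (p - q) ->
  ldt (e - ez) a (hL p 0 - hL q 0).
Proof.
move=> p1 q1 pq; rewrite /hL p1.2 q1.2.
rewrite opprD addrACA subrr add0r.
apply: ldt_hlogB; try by apply: pos_heps; apply: adm_parabolic.
rewrite !heps0 p1.2 q1.2 invr1 hcst1 !mul1r.
rewrite opprB addrA subrK -mulrBr.
by rewrite addrC; apply: ldt_shift.
Qed.

End Differences.

(** * Normalization *)

Section Normalization.
Variable R : realType.
Local Notation G := (expo R).
Local Notation hahn := (hahn R).
Local Notation ez := (e_z R).
Implicit Types (u v w p q d : hahn) (e x y : G) (a b : R) (t : nat).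

(** [F0] is [f0 / z]; the last hypothesis says that it agrees with [f / z] up to and including
    [l_1 ... l_K]. *)
Variables (K : nat) (lam : R) (f F0 : hahn).
Hypotheses (lam0 : 0 < lam) (lam1 : lam < 1) (f_lead : ldt ez lam f) (f_bd : bounded K f)
  (F0_bd : bounded K F0) (F0_log : forall x, F0 x != 0 -> x.1 = 0 /\ 0 <= x)
  (F0_lead : ldt 0 lam F0) (fF0 : ldt (ones R K) 0 (hmono (- ez) * f - F0)).

Let af : adm f. Proof. exact: adm_of_ldt lam0 f_lead. Qed.

Let f0 : hahn := hmono ez * F0.

Definition conj_defect p : hahn := hcomp K f p - hcomp K p f0.

Definition dom : set G := [set e | ebounded K e /\ ez < e].
Definition cod : set G := [set e | ebounded K e /\ ez + ones R K < e].

(* [tau e] and [lcoef e] give the leading term of the effect on [conj_defect] of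
   a perturbation with leading exponent [e]. *)
Definition tau e : G := if e.1 == 1 then ez + shift_log (e - ez) else e.

Definition lcoef e : R :=
  if e.1 == 1 then lam * ln lam * ((e - ez).2 (first_log (e - ez)))%:~R
  else lam `^ e.1 - lam.

Lemma dom_fst e : dom e -> e.1 != 1 -> 1 < e.1.
Proof. by move=> [_ /eltE[//|[/= <- _]]]; rewrite eqxx. Qed.

Lemma dom_log e : dom e -> e.1 = 1 ->
  [/\ 0 < e - ez, (e - ez).1 = 0 & ebounded K (e - ez)].
Proof.
move=> [be eze] e1; split.
- by rewrite -(expo_ltD2r ez) add0r subrK.
- by rewrite -[LHS]/(e.1 - 1) e1 subrr.
- by apply: eboundedD be _; apply: eboundedN.
Qed.

Let ln_lam_neq0 : ln lam != 0.
Proof. by rewrite lt_eqF // ln_lt0 // lam0. Qed.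

(** Rests on [ln lam] being nonzero, so that [lam^alpha = lam] forces [alpha = 1], and on the first
    nonzero logarithmic exponent being positive when [alpha = 1]. *)
Lemma lcoef_neq0 e : dom e -> lcoef e != 0.
Proof.
move=> de; rewrite /lcoef; case: ifPn => [/eqP e1|e1].
  have [x0 x1 xb] := dom_log de e1; have [_ _ xj] := first_logP x0 x1 xb.
  apply: mulf_neq0; last by rewrite intr_eq0 gt_eqF.
  by apply: mulf_neq0 => //; rewrite gt_eqF.
have e1' := dom_fst de e1; apply/eqP => /eqP; rewrite subr_eq0 => /eqP /(congr1 (@ln R)).
rewrite ln_powR -[RHS]mul1r => /(mulIf ln_lam_neq0) e1E.
by rewrite e1E eqxx in e1.
Qed.

Lemma fst_lt x y : x.1 < y.1 -> x < y.
Proof. by move=> xy; apply/eltE; left. Qed.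

Lemma lt_fst x y : x < y -> x.1 <= y.1.
Proof. by move=> /eltE[/ltW//|[-> _]]. Qed.

Lemma tau_fst e : (tau e).1 = e.1.
Proof.
rewrite /tau; case: eqP => // e1.
by rewrite -[LHS]/(1 + (e.1 - 1 + 0)) e1 subrr !addr0.
Qed.

Lemma tau_mono x y : dom x -> dom y -> x < y -> tau x < tau y.
Proof.
move=> dx dy xy; have := lt_fst xy; rewrite le_eqVlt => /orP[/eqP xy1|xy1]; last first.
  by apply: fst_lt; rewrite !tau_fst.
rewrite /tau xy1; case: eqP => // y1.
have [x0 x1 xb] := dom_log dx (etrans xy1 y1); have [y0 y1' yb] := dom_log dy y1.
by rewrite expo_ltD2l; apply: shift_log_lt x1 xb y1' yb _ => //; rewrite expo_ltD2r.
Qed.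

Lemma tau_cod e : dom e -> cod (tau e).
Proof.
move=> de; have [be eze] := de; rewrite /tau; case: eqP => [e1|/eqP e1].
  have [x0 x1 xb] := dom_log de e1; have [jK _ _] := first_logP x0 x1 xb.
  split; last by rewrite expo_ltD2l; apply: shift_log_gt.
  by apply: eboundedD => //; apply: eboundedD => //; apply: ebounded_ones.
split=> //; apply: fst_lt; rewrite -[X in X < _]/(1 + 0) addr0; exact: dom_fst.
Qed.

Lemma tau_surj y : cod y -> exists2 e, dom e & tau e = y.
Proof.
move=> [yb yK]; have := lt_fst yK; rewrite -[X in X <= _]/(1 + 0) addr0.
rewrite le_eqVlt => /orP[/eqP y1|y1]; last first.
  exists y; first by split=> //; apply: fst_lt.
  by rewrite /tau gt_eqF.
have y1' : (y - ez).1 = 0 by rewrite -[LHS]/(y.1 - 1) -y1 subrr.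
have yb' : ebounded K (y - ez) by apply: eboundedD yb _; apply: eboundedN.
have [|x [x0 x1 xb xy]] := shift_log_surj y1' yb'.
  by rewrite -(expo_ltD2r ez) subrK addrC.
exists (ez + x).
  split; first exact: eboundedD.
  by rewrite -[X in X < _]addr0 expo_ltD2l.
have -> : tau (ez + x) = ez + shift_log (ez + x - ez).
  by rewrite /tau -[(ez + x).1]/(1 + x.1) x1 addr0 eqxx.
by rewrite [ez + x]addrC addrK xy addrC subrK.
Qed.

Lemma hmonoVK x u : hmono x * (hmono (- x) * u) = u.
Proof. by rewrite mulrA -hmonoD subrr hmono0 mul1r. Qed.

(** Composition with [z] is the identity, so this is a difference of two compositions, to which
    [ldt_MgB] applies with exponent 0 and coefficient [ln lam]. *)
Lemma ldt_hcomp_sub x a d : 0 < x -> x.1 = 0 -> ebounded K x -> bounded K d -> ldt x a d ->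
  ldt (shift_log x) (a * (ln lam * (x.2 (first_log x))%:~R)) (hcomp K f d - d).
Proof.
move=> x0 x1 xb bd dx; have ai := adm_hid R.
have L : ldt 0 (ln lam) (hL f 0 - hL (hid R) 0).
  by rewrite hL_hid subr0; have := ldt_hL (pos_heps 0 af); rewrite f_lead.2.
rewrite -[X in _ - X](hcomp_hid K).
have h y : ldt (shift_log x) (if y == x then a * (ln lam * (x.2 (first_log x))%:~R) else 0)
    (hcst (d y) * (Mg K f y - Mg K (hid R) y)).
  have [yx|yx] := eqVneq y x.
    by rewrite yx dx.2; apply: ldtZ; have := ldt_MgB af ai L x0 x1 xb; rewrite add0r.
  have [->|dy] := eqVneq (d y) 0; first by rewrite hcst0 mul0r; apply: ldt00.
  have xy : x < y by rewrite lt_neqAle eq_sym yx (ldt_supp_ge dx).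
  have := lt_fst xy; rewrite x1 le_eqVlt => /orP[/eqP y1|y1].
    have yb : ebounded K y by apply: bd.
    apply: ldt_lt (ldtZ (d y) (ldt_MgB af ai L (lt_trans x0 xy) (esym y1) yb)).
    by rewrite add0r; apply: shift_log_lt xb _ yb xy.
  apply: ldt_lt (ldtZ (d y) (ldtB (ldt_Mg K y af) (ldt_Mg K y ai))).
  by apply: fst_lt; rewrite -[X in X < _]/(x.1 + 0) x1 addr0.
apply: ldt_eq (ldt_fsum (fun y => hcompB_fsum K d y af ai) h) _ _ => //.
by rewrite (@fsum1 _ _ _ x) ?eqxx// => y /negbTE ->.
Qed.

(** Here [A = p o f], [B = q o f], [C = p], [D = q], [W = F0 o p] and [W' = F0 o q]. *)
Let defect_split (V : comNzRingType) (A B C D W W' : V) :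
  A - C * W - (B - D * W') = A - B - (C - D) * W - D * (W - W').
Proof. by ring. Qed.

(** Here [Z = z], [F = f / z], [D = (p - q) / z], [C = D o f] and [W = F0 o p]; the parts that
    cancel to first order are paired. *)
Let defect_linear (V : comNzRingType) (Z F D C W : V) :
  Z * F * C - Z * D * W = Z * (F * (C - D) + D * (F - W)).
Proof. by ring. Qed.

(** For [alpha > 1] the coefficients [lam^alpha] and [lam] do not cancel. For [alpha = 1] they do;
    with [d = (p - q) / z], what remains is [z F (d o f - d)], while [z d (F - F0 o p)] and the
    nonlinear term vanish up to [tau e]. *)
Lemma ldt_conj_defect p q e a : ldt ez 1 p -> ldt ez 1 q -> bounded K p -> bounded K q ->
  dom e -> ldt e a (p - q) ->
  ldt (tau e) (lcoef e * a) (conj_defect p - conj_defect q).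
Proof.
move=> p1 q1 bp bq de pq; have ap := adm_parabolic p1; have aq := adm_parabolic q1.
have ai := adm_hid R.
have [be eze] := de.
have comp_f0 u (au : adm u) : hcomp K u f0 = u * hcomp K u F0.
  by rewrite /f0 (hcompM K au) (hcomp_hmono K au) (Mg_ez K au).
rewrite /conj_defect (comp_f0 p ap) (comp_f0 q aq) defect_split -(hcompB K af).
have W1 : ldt 0 lam (hcomp K p F0).
  by have := ldt_hcomp K ap F0_lead; rewrite powRr0 mulr1.
(* The nonlinear part: replacing [p] by [q] inside [F0] is felt only beyond [e] times
   [l_1 ... l_K]. *)
have V1 : ldt (e + ones R K) 0 (q * (hcomp K p F0 - hcomp K q F0)).
  have := ldt_hcompB ap aq (ldt_hLB_parabolic p1 q1 pq) F0_bd F0_log.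
  by move=> /(ldtM q1); rewrite mulr0 addrA [ez + _]addrC subrK.
rewrite /tau /lcoef; case: eqP => [e1|/eqP e1]; last first.
  have A1 := ldt_hcomp K af pq; rewrite f_lead.2 in A1.
  have B1 := ldtM pq W1; rewrite addr0 in B1.
  have C1 : ldt e 0 (q * (hcomp K p F0 - hcomp K q F0)).
    by apply: ldt_le V1; rewrite expo_leDr // ones_ge0.
  by apply: ldt_eq (ldtB (ldtB A1 B1) C1) erefl _; ring.
have [x0 x1 xb] := dom_log de e1; have [jK _ _] := first_logP x0 x1 xb.
set x := e - ez in x0 x1 xb jK *; have eE : e = ez + x by rewrite /x addrC subrK.
pose d := hmono (- ez) * (p - q); pose F := hmono (- ez) * f.
have d1 : ldt x a d by rewrite /x addrC; apply: ldt_shift.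
have F1 : ldt 0 lam F by have := ldt_shift (- ez) f_lead; rewrite addNr.
have bd : bounded K d.
  apply: boundedM; first by apply: bounded_hmono; apply: eboundedN.
  exact: boundedB.
have dE : p - q = hmono ez * d by rewrite hmonoVK.
have fE : f = hmono ez * F by rewrite hmonoVK.
have CdE : hcomp K f (p - q) = hmono ez * F * hcomp K f d.
  by rewrite dE (hcompM K af) (hcomp_hmono K af) (Mg_ez K af) -fE.
have le : x + ones R (first_log x).+1 <= x + ones R K by rewrite expo_leD2l ones_le.
rewrite CdE dE defect_linear.
have C1 : ldt (ez + shift_log x) 0 (q * (hcomp K p F0 - hcomp K q F0)).
  by apply: ldt_le V1; rewrite eE -addrA expo_leD2l.
have A1 := ldtM F1 (ldt_hcomp_sub x0 x1 xb bd d1); rewrite add0r in A1.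
(* [f / z] agrees with [F0] up to [l_1 ... l_K], and a parabolic inner series alters [F0] only
   beyond that. *)
have FW : ldt (ones R K) 0 (F - hcomp K p F0).
  have -> : F - hcomp K p F0 = F - F0 - (hcomp K p F0 - F0) by ring.
  rewrite -[X in ldt _ X](subr0 0); apply: ldtB => //.
  have pz : ldt ez 0 (p - hid R) by have := ldtB p1 (ldt_hid R); rewrite subrr.
  have := ldt_hcompB ap ai (ldt_hLB_parabolic p1 (ldt_hid R) pz) F0_bd F0_log.
  by rewrite hcomp_hid subrr add0r.
have B1 := ldt_le le (ldt_eq (ldtM d1 FW) erefl (mulr0 a)).
apply: ldt_eq (ldtB (ldt_shift ez (ldtD A1 B1)) C1) erefl _; ring.
Qed.

Lemma conj_defect_inj p q : ldt ez 1 p -> ldt ez 1 q -> bounded K p -> bounded K q ->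
  conj_defect p = conj_defect q -> p = q.
Proof.
move=> p1 q1 bp bq E; apply/eqP; rewrite -subr_eq0; apply/negPn/negP.
move=> /ldt_exists[e [pqe pql]].
have de : dom e.
  split; first by apply: (boundedB bp bq).
  by apply: (ldt_supp_gt ez (p - q)).1 pqe; have := ldtB p1 q1; rewrite subrr.
have [_] := ldt_conj_defect p1 q1 bp bq de pql.
by rewrite E subrr => /esym/eqP; rewrite mulf_eq0 (negbTE pqe) (negbTE (lcoef_neq0 de)).
Qed.

Lemma par_of_dom u : supp u `<=` dom -> ldt ez 1 (hid R + u) /\ bounded K (hid R + u).
Proof.
move=> du; split.
  have u0 : ldt ez 0 u by apply/ldt_supp_gt => x /du[].
  by have := ldtD (ldt_hid R) u0; rewrite addr0.
apply: boundedD; first exact: bounded_hmono.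
by move=> x /du[].
Qed.

(** True for [z], whose defect is [f - f0]; passing from [z] to [p] changes the defect only from
    some [tau e] on, which lies in [cod]. *)
Lemma conj_defect_cod p : ldt ez 1 p -> bounded K p -> supp (conj_defect p) `<=` cod.
Proof.
move=> p1 bp; have ap := adm_parabolic p1.
have bi : bounded K (hid R) by apply: bounded_hmono.
have bf0 : bounded K f0 by apply: boundedM => //; apply: bounded_hmono.
have bE : bounded K (conj_defect p) by apply: boundedB; apply: bounded_hcomp.
suff EK : ldt (ez + ones R K) 0 (conj_defect p).
  by move=> y hy; split; [apply: bE|apply: (ldt_supp_gt _ _).1 EK _ hy].
have Ei : ldt (ez + ones R K) 0 (conj_defect (hid R)).
  rewrite /conj_defect hcomp_hid (hcomp_hmono K af) (Mg_ez K af).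
  have -> : f - f0 = hmono ez * (hmono (- ez) * f - F0) by rewrite mulrBr hmonoVK.
  exact: ldt_shift.
have [pi|] := eqVneq (p - hid R) 0.
  by move/eqP: pi; rewrite subr_eq0 => /eqP ->.
move=> /ldt_exists[e [pqe pql]].
have de : dom e.
  split; first by apply: (boundedB bp bi).
  by apply: (ldt_supp_gt ez (p - hid R)).1 pqe; have := ldtB p1 (ldt_hid R); rewrite subrr.
have := ldt_lt (tau_cod de).2 (ldt_conj_defect p1 (ldt_hid R) bp bi de pql).
by move=> /ldtD /(_ Ei); rewrite addr0 subrK.
Qed.

Lemma conj_solution : exists p, [/\ ldt ez 1 p, bounded K p & hcomp K f p = hcomp K p f0].
Proof.
have [||u du Eu] := @solver R dom cod tau lcoef (fun u => conj_defect (hid R + u))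
    tau_surj tau_mono lcoef_neq0.
- by move=> u /par_of_dom[u1 bu]; apply: conj_defect_cod.
- move=> u v e a /par_of_dom[u1 bu] /par_of_dom[v1 bv] de uv.
  apply: ldt_conj_defect => //.
  by rewrite opprD addrACA subrr add0r.
have [u1 bu] := par_of_dom du; exists (hid R + u); split=> //.
by apply/eqP; rewrite -subr_eq0 -/(conj_defect _) Eu.
Qed.

End Normalization.

(** * Compositional inverses of parabolic series *)

Section Inverse.
Variable R : realType.
Local Notation G := (expo R).
Local Notation hahn := (hahn R).
Local Notation ez := (e_z R).
Variable K : nat.
Implicit Types (p q : hahn).

(** Composition with a parabolic series preserves leading terms, so the solver applies to
    [(z + u) o p - z] with the identity on exponents and coefficient 1. *)
Lemma left_inverse p : ldt ez 1 p -> bounded K p ->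
  exists q, [/\ ldt ez 1 q, bounded K q & hcomp K p q = hid R].
Proof.
move=> p1 bp; have ap := adm_parabolic p1.
have bi : bounded K (hid R) by apply: bounded_hmono.
pose D : set G := @dom R K.
have [|||||u du Eu] := @solver R D D id (fun=> 1) (fun u => hcomp K p (hid R + u) - hid R).
- by move=> y Dy; exists y.
- by [].
- by move=> e _; rewrite oner_eq0.
- move=> u /par_of_dom[u1 bu] e he; split.
    by apply: (boundedB _ bi) he; apply: bounded_hcomp.
  apply: (ldt_supp_gt _ _).1 he.
  have := ldt_hcomp K ap u1; rewrite p1.2 powR1 mulr1 => /ldtB /(_ (ldt_hid R)).
  by rewrite subrr.
- move=> u v e a /par_of_dom[u1 bu] /par_of_dom[v1 bv] [be eze] uv.
  rewrite mul1r opprB addrA subrK -(hcompB K ap).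
  have := ldt_hcomp K ap uv; rewrite p1.2 powR1 mulr1.
  by rewrite opprD addrACA subrr add0r.
have [u1 bu] := par_of_dom du; exists (hid R + u); split=> //.
by apply/eqP; rewrite -subr_eq0 Eu.
Qed.

(** If [r] is a left inverse of the left inverse [q], then [r = r o q o p = p]. *)
Lemma two_sided_inverse p : ldt ez 1 p -> bounded K p ->
  exists q, [/\ ldt ez 1 q, bounded K q, hcomp K p q = hid R & hcomp K q p = hid R].
Proof.
move=> p1 bp; have [q [q1 bq pq]] := left_inverse p1 bp.
have [r [r1 br qr]] := left_inverse q1 bq.
have ap := adm_parabolic p1; have aq := adm_parabolic q1.
exists q; split=> //; rewrite -[RHS]qr; congr (hcomp K q _).
have := hcompA K ap r aq; rewrite pq qr hcomp_hid => <-.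
by rewrite (hcomp_hmono K ap) (Mg_ez K ap).
Qed.

End Inverse.

(** * Transseries as Hahn series *)

Section Bridge.
Variable R : realType.
Local Notation G := (expo R).
Local Notation hahn := (hahn R).
Local Notation ez := (e_z R).
Implicit Types (h p q : hahn) (e x y : G).

Lemma bounded_le k K (f : ser R) : (k <= K)%N -> bounded k f -> bounded K f.
Proof. by move=> kK bf e /bf be j Kj; apply: be; apply: leq_trans kK Kj. Qed.

Lemma lead_is_ldt a h : lead_is a h -> ldt ez a h.
Proof.
move=> [ha hge]; split=> // x xz; apply/eqP; apply/negPn/negP => /hge[xE|/eltE zx].
  by rewrite xE ltxx in xz.
by move: (lt_trans xz zx); rewrite ltxx.
Qed.

Lemma ldt_lead_is a h : ldt ez a h -> lead_is a h.
Proof.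
move=> hl; split; first exact: hl.2.
by move=> e /(ldt_supp_ge hl); rewrite le_eqVlt => /orP[/eqP->|/eltE]; [left|right].
Qed.

Lemma inLk0_hahn k p : ldt ez 1 p -> bounded k p -> inLk0 k p.
Proof.
move=> p1 bp; split; last exact: ldt_lead_is.
split; first exact: hahn_wo.
move=> e he; split; last exact: bp.
have := ldt_supp_ge p1 he; rewrite le_eqVlt => /orP[/eqP <-|/lt_fst]; first exact: ler01.
exact: le_trans ler01.
Qed.

Lemma hahn_inL k (f : ser R) : inL k f -> exists2 h : hahn, h = f :> ser R & bounded k h.
Proof. by move=> [wf sf]; exists (Hahn wf) => // e /sf[]. Qed.

Lemma lexlt_onek k n : ~ lexle n (onek k) -> lexlt (onek k) n.
Proof.
move=> nle; case: (lexlt_total (onek k) n) => [kn|[//|nk]].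
  by case: nle; left.
by case: nle; right.
Qed.

Variables (k : nat) (lam : R) (f : hahn).
Hypotheses (f_lead : ldt ez lam f) (f_bd : bounded k f).

Lemma lin_part_wo : well_ordered (supp (lin_part k f)).
Proof.
apply: well_ordered_sub (hahn_wo f) => e; rewrite /supp /mkset /lin_part.
by case: pselect => n /=; rewrite ?eqxx.
Qed.

Definition hlin_part : hahn := Hahn lin_part_wo.

Definition log_part : hahn := hmono (- ez) * hlin_part.

Lemma log_partE : hmono ez * log_part = hlin_part.
Proof. exact: hmonoVK. Qed.

Lemma log_part_neq0 x : log_part x != 0 -> [/\ f (x + ez) != 0, x.1 = 0 & 0 <= x].
Proof.
rewrite hmonoM opprK -[hlin_part _]/(lin_part k f _) /lin_part.
case: pselect => [lin|n] /=; last by rewrite eqxx.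
have [x1 [x0 _]] := lin.
have {}x1 : x.1 = 0 by apply: (addIr 1); rewrite add0r.
have {}x0 : lexle nz x.2.
  by rewrite (_ : x.2 = (fun j => x.2 j + 0)) //; apply/funext => j; rewrite addr0.
move=> fx; split=> //; case: x0 => x0.
  by rewrite (_ : x = 0) // [x]surjective_pairing x1 -x0.
by apply/ltW/eltE; right.
Qed.

Lemma log_part_bounded K : (k <= K)%N -> bounded K log_part.
Proof.
move=> kK; apply: bounded_le kK _ => x /log_part_neq0[/f_bd fx _ _] j kj.
by have := fx j kj; rewrite -[LHS]/(x.2 j + 0) addr0.
Qed.

Lemma log_part_lead : ldt 0 lam log_part.
Proof.
split=> [x x0|].
  apply/eqP; apply/negPn/negP => /log_part_neq0[_ _].
  by rewrite leNgt x0.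
rewrite hmonoM opprK add0r -[hlin_part _]/(lin_part k f ez) /lin_part.
case: pselect => [lin|[]] /=; first exact: f_lead.2.
split=> //; split; first by left.
case: k => [|k']; first by left; apply/funext.
by right; exists 0%N.
Qed.

(** A discarded term [z l^n] exceeds [l_1 ... l_k] at one of the first [k] entries, because [f] has
    depth [k]; these entries are also 1 in [ones R K], so the gap persists for larger [K]. *)
Lemma lin_part_gap K : (k <= K)%N -> ldt (ones R K) 0 (hmono (- ez) * f - log_part).
Proof.
move=> kK; rewrite -mulrBr.
suff gap : ldt (ez + ones R K) 0 (f - hlin_part).
  by have := ldt_shift (- ez) gap; rewrite addrA addNr add0r.
apply/ldt_supp_gt => y; rewrite hvalB -[hlin_part y]/(lin_part k f y) /lin_part.
case: pselect => [lin|nlin] /=; first by rewrite subrr eqxx.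
rewrite subr0 => fy; have := ldt_supp_ge f_lead fy; rewrite le_eqVlt => /orP[/eqP yE|].
  case: nlin; rewrite -yE; split=> //; split; first by left.
  case: (k) => [|k']; first by left; apply/funext.
  by right; exists 0%N.
move=> /eltE[y1|[y1 y0]].
  by apply: fst_lt; rewrite -[X in X < _]/(1 + 0) addr0.
have [j [h hj]] : lexlt (onek k) y.2.
  by apply: lexlt_onek => yk; apply: nlin; split=> //; split=> //; right.
have jk : (j < k)%N.
  rewrite ltnNge; apply/negP => kj; move: hj.
  by rewrite (f_bd fy) // /onek ltnNge kj ltxx.
have onesE i : (i <= j)%N -> (ez + ones R K).2 i = onek k i.
  move=> ij; have ik := leq_ltn_trans ij jk.
  by rewrite -[LHS]/(0 + onek K i) add0r /onek ik (leq_trans ik).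
apply: (@elt_lex _ _ _ j).
- by rewrite -[LHS]/(1 + 0) addr0.
- by move=> i ij; rewrite onesE ?h // ltnW.
- by rewrite onesE.
Qed.

End Bridge.

Theorem mainTheorem1 (R : realType) (k : nat) (f : ser R) (lam : R) :
  inL k f -> 0 < lam < 1 -> lead_is lam f ->
  exists phi : ser R,
    (inL0 phi /\ inLk0 k phi /\
     exists psi, inL0 psi /\ compose phi psi = (@idz R) /\ compose psi phi = (@idz R) /\
                 compose (compose phi f) psi = lin_part k f) /\
    forall phi' : ser R,
      inL0 phi' ->
      (exists psi, inL0 psi /\ compose phi' psi = (@idz R) /\ compose psi phi' = (@idz R) /\
                   compose (compose phi' f) psi = lin_part k f) ->
      phi' = phi.
Proof.
move=> /hahn_inL[{}f <- bf] /andP[lam0 lam1] /lead_is_ldt fl.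
have af := adm_of_ldt lam0 fl.
have L := log_part_lead k fl.
have X := fun x (h : log_part k f x != 0) => let: And3 _ x1 x0 := log_part_neq0 h in conj x1 x0.
have [p [p1 bp pf]] := conj_solution lam0 lam1 fl bf (log_part_bounded bf (leqnn k)) X L
  (lin_part_gap fl bf (leqnn k)).
rewrite log_partE in pf.
have ap := adm_parabolic p1.
have blin : bounded k (hlin_part k f).
  rewrite -log_partE; apply: boundedM; first exact: bounded_hmono.
  exact: log_part_bounded.
exists p; split.
  have Lp := inLk0_hahn p1 bp.
  have [q [q1 bq pq qp]] := two_sided_inverse p1 bp; have aq := adm_parabolic q1.
  have Lq := inLk0_hahn q1 bq.
  split; first by split; [exists k; case: Lp|case: Lp].
  split=> //; exists q; split; first by split; [exists k; case: Lq|case: Lq].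
  rewrite (@compose_hcomp R k p q aq bp) (@compose_hcomp R k q p ap bq) pq qp; do 2!split=> //.
  rewrite (@compose_hcomp R k p f af bp) (@compose_hcomp R k _ q aq) ?pf; last exact: bounded_hcomp.
  by rewrite (hcompA k aq _ ap) qp hcomp_hid.
move=> p' [[k1 /hahn_inL[{}p' <- bp']] /lead_is_ldt p'1].
move=> [q' [[[k2 /hahn_inL[{}q' <- bq']] /lead_is_ldt q'1] [_ [qp' conj']]]].
(* A common depth for both solutions and the inverse [q'], at which injectivity of the defect is
   applied. *)
pose K := maxn k (maxn k1 k2).
have kK : (k <= K)%N by rewrite leq_maxl.
have k1K : (k1 <= K)%N by rewrite /K maxnCA leq_maxl.
have k2K : (k2 <= K)%N by rewrite /K maxnA leq_maxr.
have ap' := adm_parabolic p'1; have aq' := adm_parabolic q'1.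
have bK := bounded_le kK bf; have bpK := bounded_le kK bp.
have bpK' := bounded_le k1K bp'; have bqK' := bounded_le k2K bq'.
have blinK := bounded_le kK blin.
have hval_inj : injective (@hval R) by move=> u v uv; apply: hahn_ext => e; rewrite uv.
congr hval; apply: (conj_defect_inj lam0 lam1 fl (log_part_bounded bf kK) X L
  (lin_part_gap fl bf kK)) => //.
have defect0 (u : hahn R) : hcomp K f u = hcomp K u (hlin_part k f) ->
    conj_defect K f (log_part k f) u = 0.
  by move=> E; rewrite /conj_defect log_partE E subrr.
rewrite !defect0 //.
  (* The equation for [p] is known at level [k] and carried to level [K] through [compose]. *)
  apply: hval_inj; rewrite -(@compose_hcomp R K p f af bpK) -(@compose_hcomp R K _ p ap blinK).
  by rewrite (@compose_hcomp R k p f af bp) (@compose_hcomp R k _ p ap blin) pf.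
(* Composing [p' o f o q' = f0] on the right with [p'] removes [q'] and gives [p' o f = f0 o p']. *)
have E1 : hcomp K q' (hcomp K f p') = hlin_part k f.
  apply: hval_inj; rewrite -(@compose_hcomp R K _ q' aq'); last exact: bounded_hcomp.
  by rewrite -(@compose_hcomp R K p' f af bpK').
have E2 : hcomp K p' q' = hid R by apply: hval_inj; rewrite -(@compose_hcomp R K q' p' ap' bqK').
by rewrite -E1 (hcompA K ap' _ aq') E2 hcomp_hid.
Qed.
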